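(* Let $k$ be a field, $n$ a positive integer, $A$ a (commutative) $k$-algebra, and $I\subseteq A\otimes_k k[x]_{(x)}$ an ideal. Write $M=A\otimes_k k[x]_{(x)}/I$. The following two assertions are equivalent. (1) $M$ is a flat $A$-module such that for every prime ideal $P$ in $A$ the $\kappa(P)$-vector space $M\otimes_A\kappa(P)$ has dimension $n$, and there is an inclusion of ideals $(x)\subseteq\mathfrak{R}(I)$ in $A\otimes_k k[x]_{(x)}$. (2) The ideal $I$ is generated by an element $F(x)$ in $A[x]$ of the form $F(x)=x^n-u_1x^{n-1}+\dots+(-1)^nu_n$, where the coefficients $u_1,\ldots,u_n\in A$ are nilpotent.
   Context: $k[x]_{(x)}$ is the localization of the polynomial ring $k[x]$ at the maximal ideal $(x)$; $A\otimes_k k[x]_{(x)}$ is the localization of $A[x]=A\otimes_k k[x]$ in the multiplicatively closed set of $f\in k[x]$ with $f(0)\ne0$. $\mathfrak{R}(I)$ is the radical of $I$, and $\kappa(P)=A_P/PA_P$. *)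

(* Defs.v *)
From HB Require Import structures.
From mathcomp Require Import all_boot all_algebra.
From mathcomp Require Import boolp classical_sets.
From mathcomp Require Import ring.
From mathcomp.multinomials Require Import freeg.

Set Implicit Arguments.
Unset Strict Implicit.
Unset Printing Implicit Defensive.

Import GRing.Theory.
Local Open Scope ring_scope.
Local Open Scope quotient_scope.
Local Open Scope classical_set_scope.

(* A submodule of [V] is a [submodClosed V] and an ideal of [R] is a
   [submodClosed R^o].  Membership predicates are boolean, which is no
   restriction in the presence of [boolp]; ideals are not assumed proper and
   rings may be zero, so [ring_quotient.idealr] does not apply. *)

Section Span.
Variables (R : pzRingType) (V : lmodType R) (X : set V).

Definition submod_span_pred : {pred V} :=
  fun v => `[< forall W : submodClosed V, X `<=` [set` W] -> v \in W >].

Lemma submod_span_closed : submod_closed submod_span_pred.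
Proof.
split=> [|a u v /asboolP Xu /asboolP Xv]; apply/asboolP => W XW.
  exact: rpred0.
by apply: rpredD; [apply: rpredZ; apply: Xu | apply: Xv].
Qed.

Definition submod_span : submodClosed V :=
  HB.pack submod_span_pred
    (GRing.isSubmodClosed.Build R V submod_span_pred submod_span_closed).

End Span.

Section Span_lemmas.
Variables (R : pzRingType) (V : lmodType R) (X : set V).

Lemma mem_submod_span x : X x -> x \in submod_span X.
Proof. by move=> Xx; apply/asboolP => W XW; apply: XW. Qed.

Lemma submod_span_min (W : submodClosed V) : X `<=` [set` W] -> {subset submod_span X <= W}.
Proof. by move=> XW v /asboolP; apply. Qed.

End Span_lemmas.

Section QuotientModule.
Variables (R : pzRingType) (V : lmodType R) (W : submodClosed V).

Definition submod_zmodClosed : zmodClosed V :=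
  HB.pack (W : {pred V})
    (GRing.isSubmodClosed.Build R V (W : {pred V}) (submodClosedP W)).

Definition mquot : Type := Quotient.quot submod_zmodClosed.

HB.instance Definition _ := GRing.Zmodule.on mquot.

Definition mquot_pi : V -> mquot := \pi_(Quotient.quot submod_zmodClosed).

Lemma mquot_piB : {morph mquot_pi : u v / u - v}.
Proof. by move=> u v; rewrite /mquot_pi raddfB. Qed.

Lemma mquot_piD : {morph mquot_pi : u v / u + v}.
Proof. by move=> u v; rewrite /mquot_pi raddfD. Qed.

Lemma mquot_pi_eq u v : (mquot_pi u == mquot_pi v) = (u - v \in W).
Proof. by rewrite /mquot_pi -Quotient.idealrBE. Qed.

Lemma mquot_pi_repr (q : mquot) : mquot_pi (repr q) = q.
Proof. exact: reprK. Qed.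

Lemma mquot_pi_ind (T : mquot -> Prop) : (forall v, T (mquot_pi v)) -> forall q, T q.
Proof. by move=> Tpi q; rewrite -(mquot_pi_repr q). Qed.

Definition mquot_scale (a : R) (q : mquot) : mquot := mquot_pi (a *: repr q).

Lemma mquot_scaleE a v : mquot_scale a (mquot_pi v) = mquot_pi (a *: v).
Proof.
apply/eqP; rewrite mquot_pi_eq -scalerBr; apply: rpredZ.
by rewrite -mquot_pi_eq mquot_pi_repr.
Qed.

Let scaleA a b q : mquot_scale a (mquot_scale b q) = mquot_scale (a * b) q.
Proof. by elim/mquot_pi_ind: q => v; rewrite !mquot_scaleE scalerA. Qed.
Let scale1 : left_id 1 mquot_scale.
Proof. by elim/mquot_pi_ind => v; rewrite mquot_scaleE scale1r. Qed.
Let scaleDr : right_distributive mquot_scale +%R.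
Proof.
move=> a; elim/mquot_pi_ind=> u; elim/mquot_pi_ind=> v.
by rewrite -mquot_piD !mquot_scaleE scalerDr mquot_piD.
Qed.
Let scaleDl q : {morph mquot_scale^~ q : a b / a + b}.
Proof.
by elim/mquot_pi_ind: q => v a b; rewrite !mquot_scaleE scalerDl mquot_piD.
Qed.

HB.instance Definition _ :=
  GRing.Zmodule_isLmodule.Build R mquot scaleA scale1 scaleDr scaleDl.

Lemma mquot_pi_is_linear : linear mquot_pi.
Proof. by move=> a u v; rewrite mquot_piD -mquot_scaleE. Qed.

HB.instance Definition _ := GRing.isLinear.Build R V mquot *:%R mquot_pi mquot_pi_is_linear.

End QuotientModule.

Section QuotientRing.
Variables (R : comPzRingType) (I : submodClosed R^o).

Definition rquot : Type := mquot I.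

HB.instance Definition _ := GRing.Zmodule.on rquot.

Definition rquot_pi : R -> rquot := @mquot_pi R R^o I.

Definition rquot_mul (p q : rquot) : rquot :=
  rquot_pi (repr (p : mquot I) * repr (q : mquot I)).

Lemma rquot_pi_eq (a b : R) : (rquot_pi a == rquot_pi b) = (a - b \in I).
Proof. exact: (@mquot_pi_eq R R^o I). Qed.

Lemma rquot_pi_ind (T : rquot -> Prop) : (forall a, T (rquot_pi a)) -> forall q, T q.
Proof. exact: (@mquot_pi_ind R R^o I T). Qed.

Lemma rquot_piD : {morph rquot_pi : a b / a + b}.
Proof. exact: (@mquot_piD R R^o I). Qed.

Lemma rquot_piM : {morph rquot_pi : a b / a * b >-> rquot_mul a b}.
Proof.
move=> a b; apply/esym/eqP; rewrite rquot_pi_eq.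
have reprB (c : R) : (repr (rquot_pi c : mquot I) : R) - c \in I.
  by rewrite -(@mquot_pi_eq R R^o) mquot_pi_repr.
set a' := (repr _ : R); set b' := (repr _ : R).
have -> : a' * b' - a * b = a' * (b' - b) + b * (a' - a).
  by rewrite !mulrBr addrA [b * a']mulrC [b * a]mulrC subrK.
have IM (c d : R) : d \in I -> c * d \in I := @rpredZ R R^o I c d.
by apply: (@rpredD R^o I); apply: IM; apply: reprB.
Qed.

Let mulA : associative rquot_mul.
Proof.
elim/rquot_pi_ind=> a; elim/rquot_pi_ind=> b; elim/rquot_pi_ind=> c.
by rewrite -!rquot_piM mulrA.
Qed.
Let mulC : commutative rquot_mul.
Proof. by elim/rquot_pi_ind=> a; elim/rquot_pi_ind=> b; rewrite -!rquot_piM mulrC. Qed.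
Let mul1 : left_id (rquot_pi 1) rquot_mul.
Proof. by elim/rquot_pi_ind=> a; rewrite -rquot_piM mul1r. Qed.
Let mulr1' : right_id (rquot_pi 1) rquot_mul.
Proof. by move=> q; rewrite mulC mul1. Qed.
Let mulDl : left_distributive rquot_mul +%R.
Proof.
elim/rquot_pi_ind=> a; elim/rquot_pi_ind=> b; elim/rquot_pi_ind=> c.
by rewrite -rquot_piD -!rquot_piM mulrDl rquot_piD.
Qed.
Let mulDr : right_distributive rquot_mul +%R.
Proof. by move=> a b c; rewrite mulC mulDl !(mulC _ a). Qed.

HB.instance Definition _ := GRing.Zmodule_isPzRing.Build rquot
  mulA mul1 mulr1' mulDl mulDr.
HB.instance Definition _ := GRing.PzRing_hasCommutativeMul.Build rquot mulC.

Lemma rquot_pi_is_zmod_morphism : zmod_morphism rquot_pi.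
Proof. exact: (@mquot_piB R R^o I). Qed.
Lemma rquot_pi_is_monoid_morphism : monoid_morphism rquot_pi.
Proof. by split=> //; apply: rquot_piM. Qed.

HB.instance Definition _ := GRing.isZmodMorphism.Build R rquot rquot_pi
  rquot_pi_is_zmod_morphism.
HB.instance Definition _ := GRing.isMonoidMorphism.Build R rquot rquot_pi
  rquot_pi_is_monoid_morphism.

End QuotientRing.

Definition restr (R S : pzRingType) (f : {rmorphism R -> S}) (V : lmodType S) :
  Type := V.
Arguments restr {R S} f V.

Section RestrictionOfScalars.
Variables (R S : pzRingType) (f : {rmorphism R -> S}) (V : lmodType S).

HB.instance Definition _ := GRing.Zmodule.on (restr f V).

Definition restr_scale (a : R) (v : restr f V) : restr f V := f a *: (v : V).

Let scaleA a b v : restr_scale a (restr_scale b v) = restr_scale (a * b) v.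
Proof. by rewrite /restr_scale scalerA rmorphM. Qed.
Let scale1 : left_id 1 restr_scale.
Proof. by move=> v; rewrite /restr_scale rmorph1 scale1r. Qed.
Let scaleDr : right_distributive restr_scale +%R.
Proof. by move=> a u v; rewrite /restr_scale scalerDr. Qed.
Let scaleDl v : {morph restr_scale^~ v : a b / a + b}.
Proof. by move=> a b; rewrite /restr_scale rmorphD scalerDl. Qed.

HB.instance Definition _ :=
  GRing.Zmodule_isLmodule.Build R (restr f V) scaleA scale1 scaleDr scaleDl.

End RestrictionOfScalars.

Section Tensor.
Variables (R : comPzRingType) (V W : lmodType R).

Local Notation free := {freeg (V * W)%type}.
Local Notation fgen v w := (<< (v, w) >> : free).

Inductive tensor_rel : set free :=
| tensor_rel_addl v v' w :
    tensor_rel (fgen (v + v') w - fgen v w - fgen v' w)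
| tensor_rel_addr v w w' :
    tensor_rel (fgen v (w + w') - fgen v w - fgen v w')
| tensor_rel_scale a v w :
    tensor_rel (fgen (a *: v) w - fgen v (a *: w)).

(* Only the underlying abelian group; module structures are put on aliases. *)
Definition tensor : Type := mquot (submod_span tensor_rel).

HB.instance Definition _ := GRing.Zmodule.on tensor.

Definition tens (v : V) (w : W) : tensor := mquot_pi (submod_span tensor_rel) (fgen v w).

Lemma tensor_relP (D D' : free) :
  D - D' \in submod_span tensor_rel ->
  mquot_pi (submod_span tensor_rel) D = mquot_pi (submod_span tensor_rel) D'.
Proof. by move=> DD'; apply/eqP; rewrite mquot_pi_eq. Qed.

Lemma tensDl v v' w : tens (v + v') w = tens v w + tens v' w.
Proof.
rewrite /tens -mquot_piD; apply: tensor_relP.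
by rewrite opprD addrA; apply/mem_submod_span/tensor_rel_addl.
Qed.

Lemma tensDr v w w' : tens v (w + w') = tens v w + tens v w'.
Proof.
rewrite /tens -mquot_piD; apply: tensor_relP.
by rewrite opprD addrA; apply/mem_submod_span/tensor_rel_addr.
Qed.

Lemma tensZ a v w : tens (a *: v) w = tens v (a *: w).
Proof. exact/tensor_relP/mem_submod_span/tensor_rel_scale. Qed.

Lemma tens0l w : tens 0 w = 0.
Proof. by apply: (addrI (tens 0 w)); rewrite -tensDl !addr0. Qed.

Lemma tensNl v w : tens (- v) w = - tens v w.
Proof. by apply: (addrI (tens v w)); rewrite -tensDl !subrr tens0l. Qed.

Lemma tensor_ind (T : tensor -> Prop) :
  T 0 -> (forall t t', T t -> T t' -> T (t + t')) ->
  (forall v w, T (tens v w)) -> forall t, T t.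
Proof.
move=> T0 TD Tt; elim/mquot_pi_ind=> D.
have TS (s : seq (int * (V * W))) : T (mquot_pi _ [freeg s]).
  elim: s => [|[z [v w]] s IHs]; first by rewrite freeg_nil raddf0.
  rewrite -cat1s freeg_cat raddfD; apply: (TD) => //.
  have Tnat n u : T (tens u w *+ n).
    by elim: n => // n IHn; rewrite mulrS; apply: (TD).
  rewrite -[z]intz -freegU_mulz raddfMz -/(tens v w).
  case: z => n; first exact: Tnat.
  by rewrite NegzE mulrNz -mulNrz -tensNl; apply: Tnat.
by rewrite -(Freeg_enum D); apply: TS.
Qed.

Section Lift.
Variables (G : zmodType) (b : V -> W -> G).

Definition balanced : Prop :=
  [/\ forall v v' w, b (v + v') w = b v w + b v' w,
      forall v w w', b v (w + w') = b v w + b v w'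
    & forall a v w, b (a *: v) w = b v (a *: w)].

Let bl : free -> zmodule G := fglift (fun p => b p.1 p.2 : zmodule G).

(* Junk unless [b] is balanced. *)
Definition tensor_lift (t : tensor) : G :=
  bl (repr (t : mquot (submod_span tensor_rel))).

Hypothesis bP : balanced.

Let kerb : pred free := fun D => bl D == 0.

Let blB : {morph bl : D D' / D - D'}.
Proof. exact: lift_is_additive. Qed.
Let blU v w : bl (fgen v w) = b v w.
Proof. by rewrite /bl liftU scale1r. Qed.
Let bl0 : bl 0 = 0.
Proof. by rewrite -(subrr 0) blB subrr. Qed.
Let blD : {morph bl : D D' / D + D'}.
Proof.
move=> D D'; have -> : D + D' = D - (0 - D') by rewrite sub0r opprK.
by rewrite !blB bl0 sub0r opprK.
Qed.

Let kerb_closed : submod_closed kerb.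
Proof.
split; first by rewrite /kerb unfold_in bl0.
move=> z D D'; rewrite !unfold_in /kerb => /eqP D0 /eqP D'0.
rewrite blD D'0 addr0; apply/eqP.
have Dn n : bl (D *+ n) = 0.
  by elim: n => [|n IHn]; rewrite ?bl0 // mulrS blD D0 IHn addr0.
rewrite -[z]intz scaler_int; case: z => n; first exact: Dn.
by rewrite NegzE mulrNz -sub0r blB bl0 Dn subr0.
Qed.

Let kerbW : submodClosed free :=
  HB.pack kerb (GRing.isSubmodClosed.Build int free kerb kerb_closed).

Lemma tensor_lift_pi D : tensor_lift (mquot_pi _ D) = bl D.
Proof.
apply/eqP; rewrite -subr_eq0 -blB.
apply: (@submod_span_min _ _ tensor_rel kerbW).
  case: bP => bDl bDr bZ _ [v v' w|v w w'|a v w]; rewrite /= unfold_in /kerb.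
  - by rewrite !blB !blU bDl addrAC addrK subrr.
  - by rewrite !blB !blU bDr addrAC addrK subrr.
  - by rewrite blB !blU bZ subrr.
by rewrite -mquot_pi_eq mquot_pi_repr.
Qed.

Lemma tensor_lift_tens v w : tensor_lift (tens v w) = b v w.
Proof. by rewrite tensor_lift_pi blU. Qed.

Lemma tensor_liftD : {morph tensor_lift : t t' / t + t'}.
Proof.
by elim/mquot_pi_ind=> D; elim/mquot_pi_ind=> D'; rewrite -mquot_piD !tensor_lift_pi blD.
Qed.

Lemma tensor_lift0 : tensor_lift 0 = 0.
Proof. by apply: (addrI (tensor_lift 0)); rewrite -tensor_liftD !addr0. Qed.

End Lift.

End Tensor.

Section TensorMap.
Variables (R : comPzRingType) (V V' W W' : lmodType R).

Definition tensor_map (f : V -> V') (g : W -> W') : tensor V W -> tensor V' W' :=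
  tensor_lift (fun v w => tens (f v) (g w)).

Lemma tensor_map_balanced (f : V -> V') (g : W -> W') : linear f -> linear g ->
  balanced (fun v w => tens (f v) (g w)).
Proof.
move=> lf lg; split=> [v v' w|v w w'|a v w].
- by have := lf 1 v v'; rewrite !scale1r => ->; rewrite tensDl.
- by have := lg 1 w w'; rewrite !scale1r => ->; rewrite tensDr.
have f0 : f 0 = 0 by have := lf (-1) 0 0; rewrite scaler0 addr0 scaleN1r addNr.
have g0 : g 0 = 0 by have := lg (-1) 0 0; rewrite scaler0 addr0 scaleN1r addNr.
have := lf a v 0; have := lg a w 0; rewrite f0 g0 !addr0 => -> ->.
exact: tensZ.
Qed.

End TensorMap.

Section BaseChange.
Variables (R S : comPzRingType) (f : {rmorphism R -> S}) (V : lmodType R).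

(* V (x)_R S as an S-module *)
Definition base_change : Type := tensor V (restr f S^o).

HB.instance Definition _ := GRing.Zmodule.on base_change.

Definition base_change_scale (c : S) (t : base_change) : base_change :=
  tensor_map (id : V -> V) (fun s : restr f S^o => (c * (s : S) : restr f S^o)) t.

Let scale_balanced c :
  balanced (fun (v : V) (s : restr f S^o) => tens v (c * (s : S) : restr f S^o)).
Proof.
apply: (@tensor_map_balanced _ _ _ _ _ id) => // a s s'.
by rewrite mulrDr [c * (f a * _)]mulrCA.
Qed.

Lemma base_change_scaleE c v (s : S) :
  base_change_scale c (tens v (s : restr f S^o)) = tens v (c * s : restr f S^o).
Proof. exact: (tensor_lift_tens (scale_balanced c)). Qed.

Lemma base_change_scaleDr : right_distributive base_change_scale +%R.
Proof. by move=> c t t'; apply: (tensor_liftD (scale_balanced c)). Qed.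

Let scale0 c : base_change_scale c 0 = 0.
Proof. exact: (tensor_lift0 (scale_balanced c)). Qed.

Let scaleA a b t :
  base_change_scale a (base_change_scale b t) = base_change_scale (a * b) t.
Proof.
elim/tensor_ind: t => [|t t' IH IH'|v s]; first by rewrite !scale0.
  by rewrite !base_change_scaleDr IH IH'.
by rewrite !base_change_scaleE mulrA.
Qed.
Let scale1 : left_id 1 base_change_scale.
Proof.
elim/tensor_ind=> [|t t' IH IH'|v s]; first by rewrite scale0.
  by rewrite base_change_scaleDr IH IH'.
by rewrite base_change_scaleE mul1r.
Qed.
Let scaleDl t : {morph base_change_scale^~ t : a b / a + b}.
Proof.
move=> a b /=.
elim/tensor_ind: t => [|t t' IH IH'|v s]; first by rewrite !scale0 addr0.
  by rewrite !base_change_scaleDr IH IH' addrACA.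
by rewrite !base_change_scaleE mulrDl tensDr.
Qed.

HB.instance Definition _ := GRing.Zmodule_isLmodule.Build S base_change
  scaleA scale1 base_change_scaleDr scaleDl.

End BaseChange.
Arguments base_change {R S} f V.

Section TensorAlgebra.
Variables (R A C : comPzRingType).
Variables (f : {rmorphism R -> A}) (g : {rmorphism R -> C}).

Definition algtens : Type := tensor (restr f A^o) (restr g C^o).

HB.instance Definition _ := GRing.Zmodule.on algtens.

Definition atens (a : A) (c : C) : algtens :=
  tens (a : restr f A^o) (c : restr g C^o).

Definition lmul (a : A) (c : C) : algtens -> algtens :=
  tensor_lift (fun (a' : restr f A^o) (c' : restr g C^o) =>
    atens (a * (a' : A)) (c * (c' : C))).

Let lmul_balanced a c :
  balanced (fun (a' : restr f A^o) (c' : restr g C^o) =>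
    atens (a * (a' : A)) (c * (c' : C)) : tensor _ _).
Proof.
apply: (@tensor_map_balanced _ (restr f A^o) (restr f A^o)
  (restr g C^o) (restr g C^o)
  (fun a' => a * (a' : A)) (fun c' => c * (c' : C))) => r x y /=.
  by rewrite mulrDr [a * (f r * _)]mulrCA.
by rewrite mulrDr [c * (g r * _)]mulrCA.
Qed.

Let lmulE a c a' c' : lmul a c (atens a' c') = atens (a * a') (c * c').
Proof. exact: (tensor_lift_tens (lmul_balanced a c)). Qed.
Let lmulD a c : {morph lmul a c : t t' / t + t'}.
Proof. exact: (tensor_liftD (lmul_balanced a c)). Qed.
Let lmul0 a c : lmul a c 0 = 0.
Proof. exact: (tensor_lift0 (lmul_balanced a c)). Qed.

Definition algtens_mul (t t' : algtens) : algtens :=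
  tensor_lift (fun (a : restr f A^o) (c : restr g C^o) => lmul a c t') t.

Let atensDl a a' c : atens (a + a') c = atens a c + atens a' c.
Proof. exact: tensDl. Qed.
Let atensDr a c c' : atens a (c + c') = atens a c + atens a c'.
Proof. exact: tensDr. Qed.

Lemma algtens_ind (T : algtens -> Prop) :
  T 0 -> (forall t t', T t -> T t' -> T (t + t')) ->
  (forall a c, T (atens a c)) -> forall t, T t.
Proof. exact: tensor_ind. Qed.

Let mul_balanced t' : balanced
  (fun (a : restr f A^o) (c : restr g C^o) => lmul a c t' : tensor _ _).
Proof.
split=> [v v' w|v w w'|r v w]; elim/algtens_ind: t' => [|t t' IH IH'|a c].
all: rewrite ?lmul0 ?addr0 //.
- by rewrite !lmulD IH IH' addrACA.
- by rewrite !lmulE mulrDl atensDl.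
- by rewrite !lmulD IH IH' addrACA.
- by rewrite !lmulE mulrDl atensDr.
- by rewrite !lmulD IH IH'.
rewrite !lmulE -[(r *: v : A) * a]mulrA -[(r *: w : C) * c]mulrA.
exact: (tensZ (V := restr f A^o) (W := restr g C^o)).
Qed.

Lemma algtens_mulE a c a' c' :
  algtens_mul (atens a c) (atens a' c') = atens (a * a') (c * c').
Proof. by rewrite -lmulE; apply: (tensor_lift_tens (mul_balanced _)). Qed.

Let mulDl : left_distributive algtens_mul +%R.
Proof. by move=> t t' s; apply: (tensor_liftD (mul_balanced s)). Qed.
Let mul0 : left_zero 0 algtens_mul.
Proof. by move=> s; apply: (tensor_lift0 (mul_balanced s)). Qed.
Let mulE a c t : algtens_mul (atens a c) t = lmul a c t.
Proof. exact: (tensor_lift_tens (mul_balanced t)). Qed.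
Let mulr0' : right_zero 0 algtens_mul.
Proof.
elim/algtens_ind => [|t t' IH IH'|a c]; first exact: mul0.
  by rewrite mulDl IH IH' addr0.
by rewrite mulE lmul0.
Qed.
Let mulDr : right_distributive algtens_mul +%R.
Proof.
move=> t s s'; elim/algtens_ind: t => [|t t' IH IH'|a c].
- by rewrite !mul0 addr0.
- by rewrite !mulDl IH IH' addrACA.
- by rewrite !mulE lmulD.
Qed.
Let mulC : commutative algtens_mul.
Proof.
elim/algtens_ind => [s|t t' IH IH' s|a c].
- by rewrite mul0 mulr0'.
- by rewrite mulDl mulDr IH IH'.
elim/algtens_ind => [|t t' IH IH'|a' c'].
- by rewrite mul0 mulr0'.
- by rewrite mulDl mulDr IH IH'.
- by rewrite !algtens_mulE [a * _]mulrC [c * _]mulrC.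
Qed.
Let mulA : associative algtens_mul.
Proof.
elim/algtens_ind => [s u|t t' IH IH' s u|a c].
- by rewrite !mul0.
- by rewrite !mulDl IH IH'.
elim/algtens_ind => [u|t t' IH IH' u|a' c'].
- by rewrite !(mul0, mulr0').
- by rewrite !(mulDl, mulDr) IH IH'.
elim/algtens_ind => [|t t' IH IH'|a'' c''].
- by rewrite !mulr0'.
- by rewrite !mulDr IH IH'.
- by rewrite !algtens_mulE !mulrA.
Qed.
Let mul1 : left_id (atens 1 1) algtens_mul.
Proof.
elim/algtens_ind => [|t t' IH IH'|a c]; first by rewrite mulr0'.
  by rewrite mulDr IH IH'.
by rewrite algtens_mulE !mul1r.
Qed.
Let mulr1' : right_id (atens 1 1) algtens_mul.
Proof. by move=> t; rewrite mulC mul1. Qed.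

HB.instance Definition _ := GRing.Zmodule_isPzRing.Build algtens
  mulA mul1 mulr1' mulDl mulDr.
HB.instance Definition _ := GRing.PzRing_hasCommutativeMul.Build algtens mulC.

Lemma atensM a c a' c' : atens a c * atens a' c' = atens (a * a') (c * c').
Proof. exact: algtens_mulE. Qed.

Definition alg_inl (a : A) : algtens := atens a 1.
Definition alg_inr (c : C) : algtens := atens 1 c.

Lemma alg_inl_is_zmod_morphism : zmod_morphism alg_inl.
Proof.
by move=> a a'; apply: (addIr (alg_inl a')); rewrite -atensDl !subrK.
Qed.
Lemma alg_inl_is_monoid_morphism : monoid_morphism alg_inl.
Proof. by split=> // a a'; rewrite /alg_inl atensM mulr1. Qed.
Lemma alg_inr_is_zmod_morphism : zmod_morphism alg_inr.
Proof.
by move=> c c'; apply: (addIr (alg_inr c')); rewrite -atensDr !subrK.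
Qed.
Lemma alg_inr_is_monoid_morphism : monoid_morphism alg_inr.
Proof. by split=> // c c'; rewrite /alg_inr atensM mulr1. Qed.

HB.instance Definition _ := GRing.isZmodMorphism.Build A algtens alg_inl
  alg_inl_is_zmod_morphism.
HB.instance Definition _ := GRing.isMonoidMorphism.Build A algtens alg_inl
  alg_inl_is_monoid_morphism.
HB.instance Definition _ := GRing.isZmodMorphism.Build C algtens alg_inr
  alg_inr_is_zmod_morphism.
HB.instance Definition _ := GRing.isMonoidMorphism.Build C algtens alg_inr
  alg_inr_is_monoid_morphism.

End TensorAlgebra.
Arguments algtens {R A C} f g.
Arguments alg_inl {R A C} f g a.
Arguments alg_inr {R A C} f g c.

Section Localization.
Variables (R : comPzRingType) (S : mulrClosed R).

Local Notation frac := (R * {s : R | s \in S})%type.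

Definition loc_rel (p q : frac) : bool :=
  `[< exists2 u, u \in S & u * (p.1 * sval q.2) = u * (q.1 * sval p.2) >].

Let loc_rel_refl : reflexive loc_rel.
Proof. by move=> p; apply/asboolP; exists 1; rewrite ?rpred1. Qed.
Let loc_rel_sym : symmetric loc_rel.
Proof.
by move=> p q; apply/asboolP/asboolP => -[u Su e]; exists u.
Qed.
Let loc_rel_trans : transitive loc_rel.
Proof.
move=> q p r /asboolP[u Su e] /asboolP[u' Su' e']; apply/asboolP.
exists (u * u' * sval q.2); first by rewrite !rpredM // (valP q.2).
have -> : u * u' * sval q.2 * (p.1 * sval r.2) =
          u' * sval r.2 * (u * (p.1 * sval q.2)) by ring.
have -> : u * u' * sval q.2 * (r.1 * sval p.2) =
          u * sval p.2 * (u' * (r.1 * sval q.2)) by ring.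
by rewrite e -e'; ring.
Qed.

Canonical loc_equiv := EquivRel loc_rel loc_rel_refl loc_rel_sym loc_rel_trans.

Definition loc : Type := {eq_quot loc_rel}.

HB.instance Definition _ := Choice.on loc.

Definition loc_frac (r : R) (s : {s : R | s \in S}) : loc :=
  \pi_({eq_quot loc_rel}) (r, s).

Lemma loc_frac_eqP r s r' s' :
  loc_frac r s = loc_frac r' s' <->
  exists2 u, u \in S & u * (r * sval s') = u * (r' * sval s).
Proof.
split=> [/eqmodP/asboolP //|rs]; apply/eqmodP; exact/asboolP.
Qed.

Lemma loc_ind (T : loc -> Prop) :
  (forall r s, T (loc_frac r s)) -> forall p, T p.
Proof. by move=> Tf p; rewrite -[p]reprK; case: (repr p) => r s; apply: Tf. Qed.

Definition den1 : {s : R | s \in S} := exist _ 1 (rpred1 S).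
Definition denM (s t : {s : R | s \in S}) : {s : R | s \in S} :=
  exist _ (sval s * sval t) (rpredM (valP s) (valP t)).

Definition loc_add (p q : loc) : loc :=
  let: (r, s) := repr p in let: (r', s') := repr q in
  loc_frac (r * sval s' + r' * sval s) (denM s s').
Definition loc_opp (p : loc) : loc := let: (r, s) := repr p in loc_frac (- r) s.
Definition loc_mul (p q : loc) : loc :=
  let: (r, s) := repr p in let: (r', s') := repr q in
  loc_frac (r * r') (denM s s').

Let repr_frac r s : exists r' s', repr (loc_frac r s) = (r', s') /\
  exists2 u, u \in S & u * (r' * sval s) = u * (r * sval s').
Proof.
case e : (repr (loc_frac r s)) => [r' s']; exists r', s'; split=> //.
by apply/loc_frac_eqP; rewrite /loc_frac -e; apply: reprK.
Qed.

Let addE r s r' s' : loc_add (loc_frac r s) (loc_frac r' s') =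
  loc_frac (r * sval s' + r' * sval s) (denM s s').
Proof.
have [a [t [ea [u Su eu]]]] := repr_frac r s.
have [a' [t' [ea' [u' Su' eu']]]] := repr_frac r' s'.
rewrite /loc_add ea ea'; apply/loc_frac_eqP; exists (u * u').
  by rewrite rpredM.
rewrite /=.
transitivity (u * (a * sval s) * (u' * sval t' * sval s') +
  u' * (a' * sval s') * (u * sval t * sval s)); first by ring.
by rewrite eu eu'; ring.
Qed.

Let oppE r s : loc_opp (loc_frac r s) = loc_frac (- r) s.
Proof.
have [a [t [ea [u Su eu]]]] := repr_frac r s.
rewrite /loc_opp ea; apply/loc_frac_eqP; exists u => //.
by rewrite !mulNr !mulrN eu.
Qed.

Let mulE r s r' s' : loc_mul (loc_frac r s) (loc_frac r' s') =
  loc_frac (r * r') (denM s s').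
Proof.
have [a [t [ea [u Su eu]]]] := repr_frac r s.
have [a' [t' [ea' [u' Su' eu']]]] := repr_frac r' s'.
rewrite /loc_mul ea ea'; apply/loc_frac_eqP; exists (u * u').
  by rewrite rpredM.
rewrite /=.
transitivity (u * (a * sval s) * (u' * (a' * sval s'))); first by ring.
by rewrite eu eu'; ring.
Qed.

Let frac_eq r s r' s' : r * sval s' = r' * sval s ->
  loc_frac r s = loc_frac r' s'.
Proof. by move=> e; apply/loc_frac_eqP; exists 1; rewrite ?rpred1 ?e. Qed.

Let addA : associative loc_add.
Proof.
elim/loc_ind=> r s; elim/loc_ind=> r' s'; elim/loc_ind=> r'' s''.
by rewrite !addE; apply: frac_eq => /=; ring.
Qed.
Let addC : commutative loc_add.
Proof.
elim/loc_ind=> r s; elim/loc_ind=> r' s'.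
by rewrite !addE; apply: frac_eq => /=; ring.
Qed.
Let add0 : left_id (loc_frac 0 den1) loc_add.
Proof. by elim/loc_ind=> r s; rewrite addE; apply: frac_eq => /=; ring. Qed.
Let addN : left_inverse (loc_frac 0 den1) loc_opp loc_add.
Proof.
by elim/loc_ind=> r s; rewrite oppE addE; apply: frac_eq => /=; ring.
Qed.

HB.instance Definition _ := GRing.isZmodule.Build loc addA addC add0 addN.

Let mulA : associative loc_mul.
Proof.
elim/loc_ind=> r s; elim/loc_ind=> r' s'; elim/loc_ind=> r'' s''.
by rewrite !mulE; apply: frac_eq => /=; ring.
Qed.
Let mulC : commutative loc_mul.
Proof.
elim/loc_ind=> r s; elim/loc_ind=> r' s'.
by rewrite !mulE; apply: frac_eq => /=; ring.
Qed.
Let mul1 : left_id (loc_frac 1 den1) loc_mul.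
Proof. by elim/loc_ind=> r s; rewrite mulE; apply: frac_eq => /=; ring. Qed.
Let mulr1' : right_id (loc_frac 1 den1) loc_mul.
Proof. by move=> p; rewrite mulC mul1. Qed.
Let mulDl : left_distributive loc_mul +%R.
Proof.
elim/loc_ind=> r s; elim/loc_ind=> r' s'; elim/loc_ind=> r'' s''.
rewrite [X in loc_mul X _]addE !mulE.
by apply: (etrans _ (esym (addE _ _ _ _))); apply: frac_eq => /=; ring.
Qed.
Let mulDr : right_distributive loc_mul +%R.
Proof. by move=> a b c; rewrite mulC mulDl !(mulC _ a). Qed.

HB.instance Definition _ := GRing.Zmodule_isPzRing.Build loc
  mulA mul1 mulr1' mulDl mulDr.
HB.instance Definition _ := GRing.PzRing_hasCommutativeMul.Build loc mulC.

Definition loc_map (r : R) : loc := loc_frac r den1.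

Lemma loc_fracD r s r' s' : loc_frac r s + loc_frac r' s' =
  loc_frac (r * sval s' + r' * sval s) (denM s s').
Proof. exact: addE. Qed.

Lemma loc_fracM r s r' s' : loc_frac r s * loc_frac r' s' =
  loc_frac (r * r') (denM s s').
Proof. exact: mulE. Qed.

Lemma loc_map_is_zmod_morphism : zmod_morphism loc_map.
Proof.
move=> a b; apply: (addIr (loc_map b)); rewrite subrK loc_fracD.
by apply: frac_eq => /=; ring.
Qed.
Lemma loc_map_is_monoid_morphism : monoid_morphism loc_map.
Proof.
by split=> // a b; rewrite loc_fracM; apply: frac_eq => /=; ring.
Qed.

HB.instance Definition _ := GRing.isZmodMorphism.Build R loc loc_map
  loc_map_is_zmod_morphism.
HB.instance Definition _ := GRing.isMonoidMorphism.Build R loc loc_map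
  loc_map_is_monoid_morphism.

End Localization.

Definition ideal_gen (R : comPzRingType) (X : set R) : submodClosed R^o :=
  submod_span (X : set R^o).

Lemma mem_ideal_gen (R : comPzRingType) (X : set R) x : X x -> x \in ideal_gen X.
Proof. exact: (@mem_submod_span R R^o). Qed.

Lemma ideal_gen_min (R : comPzRingType) (X : set R) (J : submodClosed R^o) a :
  (forall x, X x -> x \in J) -> a \in ideal_gen X -> a \in J.
Proof. by move=> XJ; apply: (@submod_span_min R R^o). Qed.

Record primeIdeal (R : comPzRingType) := PrimeIdeal {
  prime_ideal :> submodClosed R^o;
  prime_ideal1 : (1 : R) \notin prime_ideal;
  prime_idealM : forall a b : R,
    a * b \in prime_ideal -> (a \in prime_ideal) || (b \in prime_ideal)
}.

Section LocalizationAtPrime.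
Variables (R : comPzRingType) (P : primeIdeal R).

Definition prime_compl_pred : {pred R} := fun a => a \notin P.

Lemma prime_compl_closed : mulr_closed prime_compl_pred.
Proof.
split=> [|a b Pa Pb]; first exact: prime_ideal1.
by apply/negP => /prime_idealM /orP[]; apply/negP.
Qed.

Definition prime_compl : mulrClosed R :=
  HB.pack prime_compl_pred
    (GRing.isMulClosed.Build R prime_compl_pred prime_compl_closed).

Definition loc_prime : Type := loc prime_compl.

HB.instance Definition _ := GRing.ComPzRing.on loc_prime.

Definition loc_prime_map : {rmorphism R -> loc_prime} :=
  [the {rmorphism R -> loc prime_compl} of @loc_map R prime_compl].

(* P R_P *)
Definition loc_prime_max : submodClosed loc_prime^o :=
  ideal_gen (loc_prime_map @` [set` P]).

(* Only a [comPzRingType] instance is declared; [kappa_nonzero] and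
   [kappa_inv] show that it is a field. *)
Definition kappa : Type := rquot loc_prime_max.

HB.instance Definition _ := GRing.ComPzRing.on kappa.

Definition kappa_map : {rmorphism R -> kappa} :=
  [the {rmorphism loc_prime -> kappa} of @rquot_pi loc_prime loc_prime_max]
    \o loc_prime_map.

Lemma mem_loc_prime_max r s :
  (loc_frac r s : loc_prime) \in loc_prime_max -> r \in P.
Proof.
pose T (p : loc_prime) :=
  exists r s, p = loc_frac r s :> loc prime_compl /\ r \in P.
pose Tb : {pred loc_prime^o} := fun p => `[< T p >].
have PM (a b : R) : b \in P -> a * b \in P := @rpredZ _ _ P a b.
have PM2 (a b : R) : a \in P -> a * b \in P by rewrite mulrC; apply: (PM).
have Tc : submod_closed Tb.
  split=> [|a _ _ /asboolP[r1 [s1 [-> P1]]] /asboolP[r2 [s2 [-> P2]]]].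
    by apply/asboolP; exists 0, (den1 _); split=> //; apply: rpred0.
  apply/asboolP; elim/(@loc_ind _ prime_compl): a => b t.
  exists (b * r1 * sval s2 + r2 * (sval t * sval s1)), (denM (denM t s1) s2).
  split.
    exact: (etrans (congr1 (+%R^~ _) (loc_fracM b t r1 s1)) (loc_fracD _ _ _ _)).
  by apply: rpredD; [apply/(PM2)/(PM) | apply: (PM2)].
pose W : submodClosed loc_prime^o :=
  HB.pack Tb (GRing.isSubmodClosed.Build loc_prime loc_prime^o Tb Tc).
have sub p : (loc_prime_map @` [set` P]) p -> p \in W.
  by move=> [a Pa <-]; apply/asboolP; exists a, (den1 _).
move=> /(ideal_gen_min sub)/asboolP[r' [s' [/loc_frac_eqP[u uP e] r'P]]].
have : u * (r * sval s') \in P by rewrite e; apply/(PM)/(PM2).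
move=> /prime_idealM/orP[Pu|/prime_idealM/orP[//|Ps']].
  by rewrite (negPf uP : (u \in P) = false) in Pu.
by case: s' Ps' {e} => s' /= s'P Ps'; rewrite (negPf s'P : (s' \in P) = false) in Ps'.
Qed.

Lemma kappa_nonzero : (1 : kappa) != 0.
Proof.
rewrite -(rmorph0 (@rquot_pi loc_prime loc_prime_max)) rquot_pi_eq subr0.
by apply/negP => /mem_loc_prime_max; apply/negP/prime_ideal1.
Qed.

Lemma kappa_inv (z : kappa) : z != 0 -> exists w, w * z = 1.
Proof.
elim/rquot_pi_ind: z; elim/(@loc_ind _ prime_compl) => r s.
rewrite -(rmorph0 (@rquot_pi loc_prime loc_prime_max)) rquot_pi_eq subr0 => rs.
have rP : r \in prime_compl.
  apply/negP => Pr; case/negP: rs.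
  have -> : loc_frac r s = loc_frac 1 s * loc_map prime_compl r.
    rewrite loc_fracM; apply/loc_frac_eqP; exists 1; first exact: rpred1.
    by rewrite /=; ring.
  by apply: (@rpredZ _ _ loc_prime_max); apply: mem_ideal_gen; exists r.
exists (rquot_pi loc_prime_max (loc_frac (sval s) (exist _ r rP))).
rewrite -rmorphM; congr (rquot_pi _ _); rewrite loc_fracM.
apply/loc_frac_eqP; exists 1; first exact: rpred1.
by rewrite /=; ring.
Qed.

End LocalizationAtPrime.

Definition flat (R : comPzRingType) (V : lmodType R) : Prop :=
  forall (N N' : lmodType R) (g : {linear N -> N'}),
    injective g -> injective (tensor_map (id : V -> V) g).

Definition is_basis (R : pzRingType) (V : lmodType R) (n : nat)
    (e : 'I_n -> V) : Prop :=
  (forall c : 'I_n -> R, \sum_i c i *: e i = 0 -> forall i, c i = 0) /\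
  (forall v, exists c : 'I_n -> R, v = \sum_i c i *: e i).

Definition has_dim (R : pzRingType) (V : lmodType R) (n : nat) : Prop :=
  exists e : 'I_n -> V, is_basis e.

Definition nilpotent_elt (R : pzRingType) (a : R) : Prop := exists m, a ^+ m = 0.

Definition radical (R : comPzRingType) (I : submodClosed R^o) : set R :=
  [set a : R | exists m, a ^+ m \in I].

Section LocalPolynomials.
Variable k : fieldType.

Definition polyX_ideal : submodClosed {poly k}^o :=
  ideal_gen [set 'X].

Lemma mem_polyX_ideal (p : {poly k}) : (p \in polyX_ideal) = (p.[0] == 0).
Proof.
apply/asboolP/eqP => [Wp|p0 W WX].
  pose r0 : {pred {poly k}^o} := fun q : {poly k} => q.[0] == 0.
  have r0c : submod_closed r0.
    split=> [|a q q']; rewrite !unfold_in ?hornerC //= => /eqP q0 /eqP q'0.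
    by rewrite hornerD hornerM q0 q'0 mulr0 addr0.
  pose W : submodClosed {poly k}^o :=
    HB.pack r0 (GRing.isSubmodClosed.Build {poly k} {poly k}^o r0 r0c).
  by apply/eqP/(Wp W) => _ ->; rewrite /= unfold_in /r0 hornerX.
have /factor_theorem[q ->] : root p 0 by apply/eqP.
by rewrite subr0; apply: (@rpredZ _ _ W q); apply: WX.
Qed.

Lemma polyX_ideal1 : (1 : {poly k}) \notin polyX_ideal.
Proof. by rewrite mem_polyX_ideal hornerC oner_eq0. Qed.

Lemma polyX_idealM (p q : {poly k}) : p * q \in polyX_ideal ->
  (p \in polyX_ideal) || (q \in polyX_ideal).
Proof. by rewrite !mem_polyX_ideal hornerM mulf_eq0. Qed.

Definition polyX_prime : primeIdeal {poly k} :=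
  PrimeIdeal polyX_ideal1 polyX_idealM.

(* k[x]_(x) *)
Definition kX_loc : Type := loc_prime polyX_prime.

HB.instance Definition _ := GRing.ComPzRing.on kX_loc.

Definition kX_loc_map : {rmorphism k -> kX_loc} :=
  loc_prime_map polyX_prime \o [the {rmorphism k -> {poly k}} of polyC].

(* A commutative k-algebra is a ring morphism [phi : k -> A]; unlike with
   [comAlgType k], the zero algebra is allowed. *)
Variables (A : comPzRingType) (phi : {rmorphism k -> A}).

(* A (x)_k k[x]_(x) *)
Definition AX_loc : Type := algtens phi kX_loc_map.

HB.instance Definition _ := GRing.ComPzRing.on AX_loc.

Definition AX_loc_in : {rmorphism A -> AX_loc} :=
  [the {rmorphism A -> algtens phi kX_loc_map} of alg_inl phi kX_loc_map].

Definition AX_loc_x : AX_loc :=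
  alg_inr phi kX_loc_map (loc_prime_map polyX_prime 'X).

End LocalPolynomials.

(* Main.v *)
From HB Require Import structures.
Require Import Defs.
From mathcomp Require Import all_boot all_algebra.
From mathcomp Require Import boolp classical_sets.
From mathcomp Require Import ring zify.

Set Implicit Arguments.
Unset Strict Implicit.
Unset Printing Implicit Defensive.

Import GRing.Theory.
Local Open Scope ring_scope.
Local Open Scope classical_set_scope.

(** Write [B] for the ring [A (x)_k k[x]_(x)] and [M = B / I].

    From (2) to (1).  Let [F] be the monic polynomial of degree [n].  Modulo
    [F] the power [x ^+ n] is a combination of nilpotents, so [x] lies in the
    radical of [(F)].  Modulo any power of [x] every element of [B] is a
    polynomial in [x], hence every element of [B] can be divided by [F] with a
    remainder of degree less than [n] ([division]).  The remainder is unique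
    ([division_unique]): comparing power series coefficients in [A[[x]]], the
    coefficients of a quotient with vanishing remainder satisfy a linear
    recurrence with nilpotent coefficients that expresses each of them by later
    ones, and iterating it kills them all.  So [M] is free over [A] with
    basis [1, x, ..., x ^+ n.-1], and (1) follows.

    From (1) to (2).  A power [x ^+ m] lies in [I], so [M] is generated over [A]
    by the powers of [x] below [m].  In each fibre multiplication by [x] is
    nilpotent and [1] is a cyclic vector, so the first [n] powers
    of [x] form a basis and [x ^+ n] vanishes ([cyclic_fibre]).  By Nakayama's
    lemma ([eq0_of_fibres]) the first [n] powers of [x] generate [M], and by the
    equational criterion for flatness they are free ([flat_basis]).  Expanding
    [x ^+ n] in this basis gives a monic [F] in [I] of degree [n]; its lower
    coefficients vanish in all fibres, so they lie in all prime ideals and are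
    nilpotent.  Division by [F] now shows that [F] generates [I], because the
    remainder of an element of [I] is a relation between basis elements.

    The passage between all primes and [A] itself is everywhere the same
    fact ([prime_ideal_avoiding], from Zorn's lemma): an ideal that
    contains no power of [a] lies in a prime ideal that avoids [a].  Only two
    properties of [B] enter, truncation modulo powers of [x] and uniqueness of
    remainders, so the equivalence is first proved for any [A]-algebra with
    these properties ([monic_nilpotent_quotient]). *)

(** * Submodules and ideals *)

Section Submodules.
Variables (R : pzRingType) (V : lmodType R).

Lemma submod_span_ind (X : set V) (T : V -> Prop) :
  T 0 -> (forall u v, T u -> T v -> T (u + v)) ->
  (forall a v, T v -> T (a *: v)) -> (forall v, X v -> T v) ->
  forall v, v \in submod_span X -> T v.
Proof.
move=> T0 TD TZ TX v; pose Tb : {pred V} := fun v => `[< T v >].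
have Tc : submod_closed Tb.
  split=> [|a u w /asboolP Tu /asboolP Tw]; apply/asboolP => //.
  by apply: TD => //; apply: TZ.
pose W : submodClosed V := HB.pack Tb (GRing.isSubmodClosed.Build R V Tb Tc).
by move/(@submod_span_min _ _ X W) => /= h; apply/asboolP/h => w /TX Tw; apply/asboolP.
Qed.

Lemma submod_span_comb n (e : 'I_n -> V) v :
  v \in submod_span (range e) -> exists c : 'I_n -> R, v = \sum_i c i *: e i.
Proof.
move: v; apply: submod_span_ind => [|_ _ [c ->] [d ->]|a _ [c ->]|_ [i _ <-]].
- by exists (fun=> 0); rewrite big1 // => i _; rewrite scale0r.
- by exists (fun i => c i + d i); rewrite -big_split; apply: eq_bigr => i _; rewrite scalerDl.
- by exists (fun i => a * c i); rewrite scaler_sumr; apply: eq_bigr => i _; rewrite scalerA.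
exists (fun j => (j == i)%:R); rewrite (bigD1 i) //= eqxx scale1r big1 ?addr0 //.
by move=> j /negPf->; rewrite scale0r.
Qed.

Definition kernel (W : lmodType R) (f : {linear V -> W}) : {pred V} :=
  fun v => f v == 0.

Lemma kernel_closed (W : lmodType R) (f : {linear V -> W}) : submod_closed (kernel f).
Proof.
split=> [|a u v]; rewrite !unfold_in ?linear0 // => /eqP fu /eqP fv.
by rewrite linearP fu fv scaler0 addr0.
Qed.

Definition submod_kernel (W : lmodType R) (f : {linear V -> W}) : submodClosed V :=
  HB.pack (kernel f) (GRing.isSubmodClosed.Build R V (kernel f) (kernel_closed f)).

Lemma mem_submod_kernel (W : lmodType R) (f : {linear V -> W}) v :
  (v \in submod_kernel f) = (f v == 0).
Proof. by []. Qed.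

Lemma mquot_pi_eq0 (W : submodClosed V) v : (mquot_pi W v == 0) = (v \in W).
Proof. by rewrite -(raddf0 (mquot_pi W)) mquot_pi_eq subr0. Qed.

End Submodules.

Lemma mem_ideal_gen1 (R : comPzRingType) (y a : R) :
  (a \in ideal_gen [set y]) <-> exists b, a = b * y.
Proof.
split=> [|[b ->]]; last first.
  by apply: (@rpredZ R R^o (ideal_gen [set y]) b); apply: mem_ideal_gen.
move: a; apply: (@submod_span_ind R R^o) => [|_ _ [b ->] [c ->]|a _ [b ->]|_ ->].
- by exists 0; rewrite mul0r.
- by exists (b + c); rewrite mulrDl.
- by exists (a * b); rewrite -mulrA.
- by exists 1; rewrite mul1r.
Qed.

Lemma sum_delta (R : pzRingType) (V : lmodType R) n (e : 'I_n -> V) i :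
  \sum_j (i == j)%:R *: e j = e i.
Proof.
rewrite (bigD1 i) //= eqxx scale1r big1 ?addr0 // => j.
by rewrite eq_sym => /negPf->; rewrite scale0r.
Qed.

(** * Tensor products in coordinates *)

Section TensorFacts.
Variables (R : comPzRingType) (V W : lmodType R).

Lemma tens0r (v : V) : tens v (0 : W) = 0.
Proof. by apply: (addrI (tens v 0)); rewrite -tensDr !addr0. Qed.

Lemma tens_suml (I : Type) (r : seq I) (P : pred I) (F : I -> V) (w : W) :
  tens (\sum_(i <- r | P i) F i) w = \sum_(i <- r | P i) tens (F i) w.
Proof. by apply: (big_morph (fun v => tens v w) _ (tens0l V w)) => u v; apply: tensDl. Qed.

Lemma tensor_comb n (e : 'I_n -> V) :
  (forall v, exists c : 'I_n -> R, v = \sum_i c i *: e i) ->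
  forall t : tensor V W, exists w, t = \sum_i tens (e i) (w i).
Proof.
move=> spe; elim/tensor_ind => [|_ _ [w ->] [w' ->]|v w].
- by exists (fun=> 0); rewrite big1 // => i _; rewrite tens0r.
- by exists (fun i => w i + w' i); rewrite -big_split; apply: eq_bigr => i _; rewrite tensDr.
have [c ->] := spe v; exists (fun i => c i *: w).
by rewrite tens_suml; apply: eq_bigr => i _; rewrite tensZ.
Qed.

(** Right exactness of the tensor product, in coordinates: if [e] spans [V]
    and [K] is its module of relations, then [V (x) W] is the quotient of
    [W^n] by the submodule generated by the [(r_1 y, ..., r_n y)] with [r]
    in [K].  The inverse map sends [v (x) w] to [(c_1 w, ..., c_n w)] for any
    coordinates [c] of [v]; changing [c] does not change the class. *)
Lemma tens_sum_eq0 n (e : 'I_n -> V) (w : 'I_n -> W) :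
  (forall v, exists c : 'I_n -> R, v = \sum_i c i *: e i) ->
  \sum_i tens (e i) (w i) = 0 ->
  [ffun i => w i] \in submod_span [set [ffun i => r i *: y] | r in
     [set r : 'I_n -> R | \sum_i r i *: e i = 0] & y in [set: W]].
Proof.
move=> spe w0; set X := (X in submod_span X).
have [co coP] := choice spe.
pose b v (y : W) : mquot (submod_span X) :=
  mquot_pi _ [ffun i => co v i *: y].
have bE v c y : v = \sum_i c i *: e i -> b v y = mquot_pi _ [ffun i => c i *: y].
  move=> vE; apply/eqP; rewrite mquot_pi_eq; apply: mem_submod_span.
  exists (fun i => co v i - c i); last first.
    by exists y => //; apply/ffunP => i; rewrite !ffunE scalerBl.
  rewrite /=; under eq_bigr do rewrite scalerBl.
  by rewrite sumrB -coP -vE subrr.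
have bP : balanced b.
  split=> [v v' y|v y y'|a v y].
  - rewrite (@bE _ (fun i => co v i + co v' i)); last first.
      by under eq_bigr do rewrite scalerDl; rewrite big_split -!coP.
    rewrite -mquot_piD; congr (mquot_pi _ _).
    by apply/ffunP => i; rewrite !ffunE scalerDl.
  - rewrite -mquot_piD; congr (mquot_pi _ _).
    by apply/ffunP => i; rewrite !ffunE scalerDr.
  rewrite (@bE _ (fun i => a * co v i)); last first.
    by under eq_bigr do rewrite -scalerA; rewrite -scaler_sumr -coP.
  congr (mquot_pi _ _).
  by apply/ffunP => i; rewrite !ffunE !scalerA mulrC.
have := congr1 (tensor_lift b) w0.
rewrite tensor_lift0 // (big_morph _ (tensor_liftD bP) (tensor_lift0 bP)).
under eq_bigr => i _.
  rewrite (tensor_lift_tens bP) (@bE _ (fun j => (i == j)%:R)) ?sum_delta //.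
  over.
rewrite -raddf_sum => /eqP; rewrite mquot_pi_eq0.
rewrite (_ : \sum_i _ = [ffun i => w i]) //.
apply/ffunP => j; rewrite sum_ffunE ffunE (bigD1 j) //= ffunE eqxx scale1r.
by rewrite big1 ?addr0 // => i /negPf ij; rewrite ffunE ij scale0r.
Qed.

(** A basis has no relations, so the submodule of [tens_sum_eq0] is zero. *)
Lemma tens_basis_eq0 n (e : 'I_n -> V) (w : 'I_n -> W) : is_basis e ->
  \sum_i tens (e i) (w i) = 0 -> forall i, w i = 0.
Proof.
move=> [fre spe] /(tens_sum_eq0 spe) w0 i.
suff: [ffun i => w i] = 0 :> {ffun 'I_n -> W} by move/ffunP/(_ i); rewrite !ffunE.
move: w0; move: [ffun i => w i]; apply: submod_span_ind => [//|u v -> ->|a v ->|v [r r0 [y _ <-]]].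
- by rewrite addr0.
- by rewrite scaler0.
by apply/ffunP => j; rewrite !ffunE (fre r r0) scale0r.
Qed.

Lemma tens_sum_swap I (r : seq I) (P : pred I) (F : I -> V) (G : I -> W) :
  \sum_(i <- r | P i) tens (F i) (G i) = 0 -> \sum_(i <- r | P i) tens (G i) (F i) = 0.
Proof.
have bal : balanced (fun (v : V) (w : W) => tens w v).
  split=> [v v' w|v w w'|a v w]; first exact: tensDr; first exact: tensDl.
  by rewrite tensZ.
move=> /(congr1 (tensor_lift (fun (v : V) (w : W) => tens w v))).
rewrite (big_morph _ (tensor_liftD bal) (tensor_lift0 bal)) (tensor_lift0 bal) => h.
by rewrite -[RHS]h; apply: eq_bigr => i _; rewrite (tensor_lift_tens bal).
Qed.

End TensorFacts.

(** * Flatness *)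

Section Flatness.
Variables (R : comPzRingType) (V : lmodType R).

(** Over a basis a tensor is a family of coordinates, on which [id (x) g] acts
    by [g] itself. *)
Lemma basis_flat n (e : 'I_n -> V) : is_basis e -> flat V.
Proof.
move=> be N N' g injg t t' tt'.
have bal := @tensor_map_balanced _ V V N N' id g (fun _ _ _ => erefl) (linearP g).
have [w tE] := tensor_comb (proj2 be) t; have [w' t'E] := tensor_comb (proj2 be) t'.
have mapE (x : 'I_n -> N) : tensor_map (id : V -> V) g (\sum_i tens (e i) (x i)) =
    \sum_i tens (e i) (g (x i)).
  rewrite /tensor_map (big_morph _ (tensor_liftD bal) (tensor_lift0 bal)).
  by apply: eq_bigr => i _; rewrite (tensor_lift_tens bal).
move: tt'; rewrite tE t'E !mapE => /eqP; rewrite -subr_eq0 -sumrB.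
move=> /eqP gww'; apply: eq_bigr => i _; congr (tens _ _); apply: injg.
apply/eqP; rewrite -subr_eq0; apply/eqP; move: i.
apply: (tens_basis_eq0 be); rewrite -[RHS]gww'; apply: eq_bigr => i _.
by rewrite tensDr -(scaleN1r (g (w' i))) -tensZ scaleN1r tensNl.
Qed.

Lemma basis_base_change (S : comPzRingType) (f : {rmorphism R -> S}) n
    (e : 'I_n -> V) : is_basis e -> has_dim (base_change f V) n.
Proof.
move=> be; exists (fun i => tens (e i) (1 : restr f S^o)).
have scE (c : 'I_n -> S) : \sum_i c i *: (tens (e i) (1 : restr f S^o) : base_change f V) =
    \sum_i tens (e i) (c i : restr f S^o).
  by apply: eq_bigr => i _; rewrite [LHS](base_change_scaleE f) mulr1.
split=> [c|t]; rewrite ?scE; first exact: (tens_basis_eq0 (W := restr f S^o) be).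
have [w ->] := tensor_comb (proj2 be) t; exists w.
by rewrite scE.
Qed.

(** The equational criterion for flatness.  Let [K] be the module of
    relations between the coefficients [c].  The functional
    [v |-> \sum_i v i * c i] embeds [R^n / K] in [R], and
    [\sum_i e i (x) [delta_i]] is mapped to [(\sum_i c i *: e i) (x) 1 = 0], so
    it vanishes in [V (x) R^n / K]; by right exactness
    [(e 1, ..., e n)] lies in [K V]. *)
Lemma flat_relation n (e : 'I_n -> V) (c : 'I_n -> R) : flat V ->
  \sum_i c i *: e i = 0 ->
  [ffun i => e i] \in submod_span [set [ffun i => r i *: y] | r in
     [set r : 'I_n -> R | \sum_i r i * c i = 0] & y in [set: V]].
Proof.
move=> flV ce0.
(* [K] is the kernel of the functional [f], and [g] its factorization through
   the quotient by [K]. *)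
pose f (v : {ffun 'I_n -> R^o}) : R^o := \sum_i v i * c i.
have fL : linear f.
  move=> a u v; rewrite /f scaler_sumr -big_split; apply: eq_bigr => i _ /=.
  by rewrite !ffunE mulrDl -mulrA.
pose fl : {linear {ffun 'I_n -> R^o} -> R^o} :=
  HB.pack f (GRing.isLinear.Build R {ffun 'I_n -> R^o} R^o *:%R f fL).
pose K := submod_kernel fl.
pose g (q : mquot K) : R^o := f (repr (q : mquot K)).
have gE v : g (mquot_pi K v) = f v.
  apply/eqP; rewrite -subr_eq0 -[f _ - f _](raddfB fl).
  by rewrite -mem_submod_kernel -mquot_pi_eq mquot_pi_repr.
have gL : linear g.
  move=> a; elim/mquot_pi_ind => u; elim/mquot_pi_ind => v.
  by rewrite -linearP !gE fL.
pose gl : {linear mquot K -> R^o} :=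
  HB.pack g (GRing.isLinear.Build R (mquot K) R^o *:%R g gL).
have injg : injective gl.
  elim/mquot_pi_ind => u; elim/mquot_pi_ind => v /=; rewrite !gE => /eqP.
  by rewrite -subr_eq0 -[f _ - f _](raddfB fl) -mem_submod_kernel -mquot_pi_eq => /eqP.
pose d i : mquot K := mquot_pi K [ffun j => (i == j)%:R].
have gd i : g (d i) = c i.
  by rewrite gE /f (eq_bigr (fun j => (i == j)%:R *: (c j : R^o))) ?sum_delta // => j _; rewrite ffunE.
have fcomb (v : {ffun 'I_n -> R^o}) : mquot_pi K v = \sum_i v i *: d i.
  rewrite /d; under eq_bigr do rewrite -linearZ.
  rewrite -raddf_sum; congr (mquot_pi _ _); apply/ffunP => j; rewrite sum_ffunE.
  rewrite (bigD1 j) //= !ffunE eqxx [_ *: _]mulr1 big1 ?addr0 // => i /negPf ij.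
  by rewrite !ffunE ij scaler0.
have spd q : exists b : 'I_n -> R, q = \sum_i b i *: d i.
  by elim/mquot_pi_ind: q => v; exists v; rewrite fcomb.
have ed0 : \sum_i tens (e i) (d i) = 0.
  apply: (flV _ _ gl injg).
  have bal := @tensor_map_balanced _ V V _ _ id gl (fun _ _ _ => erefl) (linearP gl).
  rewrite /tensor_map (big_morph _ (tensor_liftD bal) (tensor_lift0 bal)).
  rewrite (tensor_lift0 bal) -[RHS](tens0l V (1 : R^o)) -ce0 tens_suml.
  apply: eq_bigr => i _; rewrite (tensor_lift_tens bal) /= gd tensZ.
  by rewrite [c i *: _]mulr1.
apply: (submod_span_min _ (tens_sum_eq0 spd (tens_sum_swap ed0))) => _ [r r0 [y _ <-]].
apply: mem_submod_span; exists r; last by exists y.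
have := congr1 gl r0; rewrite linear_sum linear0 /= => h; rewrite -[RHS]h.
by apply: eq_bigr => i _; rewrite -[g (r i *: d i)]/(gl (r i *: d i)) linearZ /= gd.
Qed.

End Flatness.

(** * Prime ideals and residue fields *)

Lemma ideal_mulr (R : comPzRingType) (J : submodClosed R^o) (a b : R) :
  b \in J -> a * b \in J.
Proof. exact: (@rpredZ R R^o J). Qed.

Lemma ideal0 (R : comPzRingType) (J : submodClosed R^o) : (0 : R) \in J.
Proof. exact: (@rpred0 R^o J). Qed.

Lemma idealD (R : comPzRingType) (J : submodClosed R^o) (a b : R) :
  a \in J -> b \in J -> a + b \in J.
Proof. exact: (@rpredD R^o J). Qed.

Lemma ideal_sum (R : comPzRingType) (J : submodClosed R^o) I (r : seq I) (P : pred I)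
    (F : I -> R) : (forall i, P i -> F i \in J) -> \sum_(i <- r | P i) F i \in J.
Proof. exact: (@rpred_sum R^o J). Qed.

Section Primes.
Variable R : comPzRingType.

(** A set maximal among those which, together with [J], generate an ideal
    containing no power of [a], generates a prime ideal: two elements outside
    that ideal would each bring in a power of [a], hence so would their
    product. *)
Lemma prime_ideal_avoiding (J : submodClosed R^o) (a : R) : ~ radical J a ->
  exists P : primeIdeal R, {subset J <= P} /\ a \notin P.
Proof.
move=> aJ; pose gen (X : set R) := ideal_gen (X `|` [set` J]).
pose avoid (X : set R) := forall m, a ^+ m \notin gen X.
have genJ X : {subset J <= gen X} by move=> b bJ; apply: mem_ideal_gen; right.
have genS X Y : X `<=` Y -> {subset gen X <= gen Y}.
  move=> XY b; apply: ideal_gen_min => c [/XY Yc|cJ].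
    by apply: mem_ideal_gen; left.
  by apply: mem_ideal_gen; right.
have genU X b c : c \in gen (X `|` [set b]) -> exists w r, w \in gen X /\ c = w + r * b.
  move: c; apply: (@submod_span_ind R R^o) => [|_ _ [w [r [wX ->]]] [w' [r' [w'X ->]]]||c].
  - by exists 0, 0; rewrite mul0r addr0; split=> //; apply: ideal0.
  - exists (w + w'), (r + r'); split; last by rewrite mulrDl addrACA.
    exact: idealD.
  - move=> s _ [w [r [wX ->]]]; exists (s * w), (s * r).
    by rewrite -mulrA -[_ *: _]/(s * _) mulrDr; split=> //; apply: ideal_mulr.
  move=> [[Xc|->]|Jc]; last by exists c, 0; rewrite mul0r addr0 genJ.
    by exists c, 0; rewrite mul0r addr0; split=> //; apply: mem_ideal_gen; left.
  by exists 0, 1; rewrite mul1r add0r; split=> //; apply: ideal0.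
(* A membership in the ideal generated by the union of a chain already holds
   for one member of the chain; the alternative [a ^+ m \in J] takes care of
   the empty chain. *)
have [F Fa Ftot|X [avX maxX]] := @Zorn_bigcup R avoid.
  move=> m; apply/negP => am.
  have [aJ'|[X FX]] : a ^+ m \in J \/ exists2 X, F X & a ^+ m \in gen X.
  - move: (a ^+ m) am; apply: (@submod_span_ind R R^o).
    + by left; apply: ideal0.
    + move=> b c [bJ|[X FX bX]] [cJ|[Y FY cY]].
      * by left; apply: idealD.
      * by right; exists Y => //; apply: idealD => //; apply: genJ.
      * by right; exists X => //; apply: idealD => //; apply: genJ.
      right; have [XY|YX] := Ftot _ _ FX FY.
        by exists Y => //; apply: idealD => //; apply: genS bX.
      by exists X => //; apply: idealD => //; apply: genS cY.
    + move=> c b [bJ|[X FX bX]]; first by left; apply: ideal_mulr.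
      by right; exists X => //; apply: ideal_mulr.
    + move=> b [[X FX Xb]|bJ]; last by left.
      by right; exists X => //; apply: mem_ideal_gen; left.
  - by apply: aJ; exists m.
  by apply/negP/Fa.
have powX b : b \notin gen X -> exists m w r, w \in gen X /\ a ^+ m = w + r * b.
  move=> bX; have /maxX : X `<` X `|` [set b].
    split=> [c|/(_ b (or_intror erefl)) Xb]; first by left.
    by case/negP: bX; apply: mem_ideal_gen; left.
  move=> /existsNP[m /negP].
  by rewrite negbK => /genU[w [r h]]; exists m, w, r.
have gen1 : (1 : R) \notin gen X by have := avX 0%N; rewrite expr0.
have genM (b c : R) : b * c \in gen X -> (b \in gen X) || (c \in gen X).
  move=> bcX; apply/negPn/negP; rewrite negb_or => /andP[/powX[m [w [r [wX mE]]]]].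
  move=> /powX[m' [w' [r' [w'X m'E]]]]; case/negP: (avX (m + m')%N).
  have -> : a ^+ (m + m') = (w' + r' * c) * w + (r * b * w' + r * r' * (b * c)).
    by rewrite exprD mE m'E; ring.
  do 2?[apply: idealD]; exact: ideal_mulr.
exists (PrimeIdeal gen1 genM); split=> [b|]; first exact: genJ.
by have := avX 1%N; rewrite expr1.
Qed.

Lemma kappa_map_eq0 (P : primeIdeal R) (a : R) : (kappa_map P a == 0) = (a \in P).
Proof.
rewrite -(rmorph0 (@rquot_pi (loc_prime P) (loc_prime_max P))) rquot_pi_eq subr0.
by apply/idP/idP => [/mem_loc_prime_max|Pa] //; apply: mem_ideal_gen; exists a.
Qed.

(** Clearing denominators: the residue field is the fraction field of the image
    of [R]. *)
Lemma kappaP (P : primeIdeal R) (z : kappa P) :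
  exists a s, kappa_map P s != 0 /\ kappa_map P s * z = kappa_map P a.
Proof.
elim/rquot_pi_ind: z; elim/(@loc_ind _ (prime_compl P)) => r s.
exists r, (sval s); split; first by rewrite kappa_map_eq0; apply: (valP s).
apply: (etrans (esym (rmorphM (@rquot_pi (loc_prime P) (loc_prime_max P)) _ _))).
congr (rquot_pi _ _); rewrite loc_fracM.
apply/loc_frac_eqP; exists 1; first exact: rpred1.
by rewrite /=; ring.
Qed.

Lemma kappa_mul_neq0 (P : primeIdeal R) (z w : kappa P) :
  z != 0 -> w != 0 -> z * w != 0.
Proof.
move=> /kappa_inv[z' z'z] w0; apply/eqP => zw; case/eqP: w0.
by rewrite -[w]mul1r -z'z -mulrA zw mulr0.
Qed.

Lemma nilpotent_kappa (a : R) :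
  (forall P : primeIdeal R, kappa_map P a = 0) -> nilpotent_elt a.
Proof.
move=> a0; apply: contrapT => aN.
have [[m]|P [_ /negP]] := @prime_ideal_avoiding (ideal_gen set0) a.
  move=> am; apply: aN; exists m; move: (a ^+ m) am.
  by apply: (@submod_span_ind R R^o) => // [b c -> ->|c b ->]; rewrite ?addr0 ?scaler0.
by apply; rewrite -kappa_map_eq0 a0.
Qed.

(** The local-global principle behind the arguments by fibres.  It is applied to
    the annihilator of a module and to the ideal generated by a determinant. *)
Lemma ideal_eq1_kappa (J : submodClosed R^o) :
  (forall P : primeIdeal R, exists2 d : R, d \in J & kappa_map P d != 0) -> (1 : R) \in J.
Proof.
move=> JP; apply: contrapT => J1.
have [[m]|P [JsP _]] := @prime_ideal_avoiding J 1; first by rewrite expr1n.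
by have [d /JsP dP] := JP P; rewrite kappa_map_eq0 dP.
Qed.

End Primes.

(** * From fibres to modules *)

Section Fibres.
Variable R : comPzRingType.

Local Notation fib P z := (z : restr (kappa_map P) (kappa P)^o).

Lemma tens_kappa (V : lmodType R) (P : primeIdeal R) (v : V) (a : R) :
  tens v (fib P (kappa_map P a)) = tens (a *: v) (fib P 1).
Proof. by rewrite tensZ [a *: _]mulr1. Qed.

(** Cramer's rule: multiply the relations by the adjugate matrix. *)
Lemma det_annihilates (V : lmodType R) m (H : 'M[R]_m) (q : 'I_m -> V) :
  (forall i, \sum_j H i j *: q j = 0) -> forall i, \det H *: q i = 0.
Proof.
move=> Hq i; transitivity (\sum_j (\adj H *m H) i j *: q j).
  rewrite mul_adj_mx -[in LHS](sum_delta q i) scaler_sumr; apply: eq_bigr => j _.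
  by rewrite !mxE scalerA mulr_natr.
under eq_bigr do rewrite mxE scaler_suml.
rewrite exchange_big /= big1 // => j _.
under eq_bigr do rewrite -scalerA.
by rewrite -scaler_sumr Hq scaler0.
Qed.

(** If a generator vanishes in the fibre, then right exactness writes the
    corresponding unit vector over the residue field as a combination of
    relations of [V]; clearing denominators leaves a single relation. *)
Lemma fibre_relation (V : lmodType R) m (q : 'I_m -> V) (P : primeIdeal R) i :
  (forall v, exists c : 'I_m -> R, v = \sum_i c i *: q i) ->
  tens (q i) (fib P 1) = 0 ->
  exists r s, [/\ \sum_j r j *: q j = 0, kappa_map P s != 0 &
    forall j, kappa_map P (r j) = kappa_map P s * (i == j)%:R].
Proof.
move=> spq qi0.
have /(tens_sum_eq0 spq) : \sum_j tens (q j) (fib P (i == j)%:R) = 0.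
  rewrite (bigD1 i) //= eqxx big1 ?addr0 // => j; rewrite eq_sym => /negPf->.
  exact: tens0r.
set v := [ffun _ => _] => vX.
suff: exists r s, [/\ \sum_j r j *: q j = 0, kappa_map P s != 0 &
    forall j, kappa_map P (r j) = kappa_map P s * (v j : kappa P)].
  by move=> [r [s [rq s0 rE]]]; exists r, s; split=> // j; rewrite rE ffunE.
move: v vX; apply: submod_span_ind => [|u v|a v|v].
- exists (fun=> 0), 1; split=> [||j]; last by rewrite !rmorph0 ffunE mulr0.
    by rewrite big1 // => j _; rewrite scale0r.
  by rewrite rmorph1 kappa_nonzero.
- move=> [r [s [rq s0 rE]]] [r' [s' [rq' s0' rE']]].
  exists (fun j => s' * r j + s * r' j), (s * s'); split=> [||j].
  + under eq_bigr do rewrite scalerDl -!scalerA.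
    by rewrite big_split /= -!scaler_sumr rq rq' !scaler0 addr0.
  + by rewrite (rmorphM (kappa_map P)); exact (kappa_mul_neq0 s0 s0').
  rewrite ffunE (rmorphD (kappa_map P)) !(rmorphM (kappa_map P)) rE rE' mulrDr -[LHS]/(_ + _ : kappa P).
  by rewrite -!mulrA [X in X + _]mulrCA.
- move=> [r [s [rq s0 rE]]]; exists (fun j => a * r j), s; split=> // [|j].
    by under eq_bigr do rewrite -scalerA; rewrite -scaler_sumr rq scaler0.
  rewrite (rmorphM (kappa_map P)) rE ffunE -[(a *: v j : kappa P)]/(kappa_map P a * v j).
  by rewrite mulrCA.
move=> [r rq [y _ <-]]; have [a [s [s0 sE]]] := kappaP y.
exists (fun j => a * r j), s; split=> // [|j].
  by under eq_bigr do rewrite -scalerA; rewrite -scaler_sumr rq scaler0.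
rewrite ffunE (rmorphM (kappa_map P)) -sE -[(r j *: y : kappa P)]/(kappa_map P (r j) * y).
by rewrite -mulrA [y * _]mulrC.
Qed.

(** Nakayama's lemma over all primes at once.  Modulo a prime [P], each
    generator satisfies a relation in which its own coefficient survives and
    all others vanish; the determinant of these relations lies outside [P]
    and annihilates the module.  So the annihilator is contained in no
    prime. *)
Lemma eq0_of_fibres (V : lmodType R) m (q : 'I_m -> V) :
  (forall v, exists c : 'I_m -> R, v = \sum_i c i *: q i) ->
  (forall (P : primeIdeal R) i, tens (q i) (fib P 1) = 0) -> forall i, q i = 0.
Proof.
move=> spq q0 i.
(* The annihilator of the generators, as the kernel of [a |-> (a q_1, ..., a q_m)]. *)
pose f (a : R^o) : {ffun 'I_m -> V} := [ffun i => (a : R) *: q i].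
have fL : linear f.
  by move=> a b c; apply/ffunP => j; rewrite !ffunE scalerDl scalerA.
pose fl : {linear R^o -> {ffun 'I_m -> V}} :=
  HB.pack f (GRing.isLinear.Build R R^o {ffun 'I_m -> V} *:%R f fL).
suff /eqP/ffunP/(_ i) : (1 : R) \in submod_kernel fl by rewrite !ffunE scale1r.
apply: ideal_eq1_kappa => P.
have [r /choice[s rs]] := choice (fun j => fibre_relation spq (q0 P j)).
exists (\det (\matrix_(j, l) r j l)).
  apply/eqP/ffunP => j; rewrite !ffunE; apply: det_annihilates => {}j.
  by have [rq _ _] := rs j; rewrite -[RHS]rq; apply: eq_bigr => l _; rewrite mxE.
rewrite -det_map_mx (_ : map_mx _ _ = diag_mx (\row_j kappa_map P (s j))).
  rewrite det_diag; apply: (big_ind (fun z => z != 0)) => [||j _].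
  - exact: kappa_nonzero.
  - by move=> z w z0 w0; exact (kappa_mul_neq0 z0 w0).
  - by rewrite mxE; case: (rs j).
apply/matrixP => j l; rewrite !mxE; have [_ _ ->] := rs j.
by rewrite mulr_natr.
Qed.

(** The determinant becomes [1] in every residue field, so it generates the unit
    ideal. *)
Lemma det_unit_of_fibres n (D : 'M[R]_n) :
  (forall (P : primeIdeal R) i j, kappa_map P (D i j) = (i == j)%:R) ->
  exists d, d * \det D = 1.
Proof.
move=> D1; have /mem_ideal_gen1[d ->] : (1 : R) \in ideal_gen [set \det D]; last by exists d.
apply: ideal_eq1_kappa => P; exists (\det D); first exact: mem_ideal_gen.
rewrite -det_map_mx (_ : map_mx _ _ = 1%:M) ?det1 ?kappa_nonzero //.
by apply/matrixP => i j; rewrite !mxE D1.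
Qed.

(** Flatness turns a relation [c] into a matrix [D] with [c D = 0] and
    [D e = e]; freeness in the fibres makes [D] the identity modulo every
    prime, hence invertible, and so [c = 0]. *)
Lemma flat_basis (V : lmodType R) n (e : 'I_n -> V) : flat V ->
  (forall v, exists c : 'I_n -> R, v = \sum_i c i *: e i) ->
  (forall (P : primeIdeal R) (z : 'I_n -> kappa P),
     \sum_i tens (e i) (fib P (z i)) = 0 -> forall i, z i = 0) ->
  is_basis e.
Proof.
move=> flV spe fre; split=> // c ce0.
have /= : exists D : 'M[R]_n, (forall l, \sum_i D i l * c i = 0) /\
    forall i, [ffun i => e i] i = \sum_l D i l *: e l.
  move: [ffun i => e i] (flat_relation flV ce0).
  apply: submod_span_ind => [|u u' [D [Dc uE]] [D' [Dc' u'E]]|a u [D [Dc uE]]|].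
  - exists 0; split=> i; first by rewrite big1 // => j _; rewrite mxE mul0r.
    by rewrite ffunE big1 // => j _; rewrite mxE scale0r.
  - exists (D + D'); split=> i.
      under eq_bigr do rewrite mxE mulrDl.
      by rewrite big_split /= Dc Dc' addr0.
    rewrite ffunE uE u'E -big_split; apply: eq_bigr => j _ /=.
    by rewrite mxE scalerDl.
  - exists (a *: D); split=> i.
      under eq_bigr do rewrite mxE -mulrA.
      by rewrite -mulr_sumr Dc mulr0.
    rewrite ffunE uE scaler_sumr; apply: eq_bigr => j _.
    by rewrite mxE scalerA.
  move=> v [r rc [y _ <-]]; have [b yE] := spe y.
  exists (\matrix_(i, l) (r i * b l)); split=> i.
    under eq_bigr do rewrite mxE mulrAC.
    by rewrite -mulr_suml rc mul0r.
  by rewrite ffunE [in LHS]yE scaler_sumr; apply: eq_bigr => j _; rewrite mxE scalerA.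
move=> [D [Dc De]]; have [P i j|d dD] := @det_unit_of_fibres _ D.
  have := fre P (fun j => kappa_map P ((i == j)%:R - D i j)).
  rewrite (_ : \sum_j _ = 0) => [/(_ erefl j)/eqP|].
    by rewrite (rmorphB (kappa_map P)) subr_eq0 (rmorph_nat (kappa_map P)) eq_sym => /eqP.
  under eq_bigr do rewrite tens_kappa scalerBl.
  by rewrite -tens_suml sumrB sum_delta -De ffunE subrr tens0l.
have cD l : \sum_i D^T l i *: (c i : R^o) = 0.
  by rewrite -[RHS](Dc l); apply: eq_bigr => i _; rewrite mxE.
move=> i; have := det_annihilates cD i; rewrite det_tr => /(congr1 (fun a => d * a)).
by rewrite mulr0 [d * _]mulrA dD mul1r.
Qed.

End Fibres.

(** * Cyclic nilpotent fibres *)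

Section Dimension.
Variables (K : comPzRingType) (K1 : (1 : K) != 0) (V : lmodType K).

Lemma basis_size_le n r (e : 'I_n -> V) (e' : 'I_r -> V) :
  is_basis e -> is_basis e' -> (n <= r)%N.
Proof.
move=> [fre spe] [_ spe'].
pose K' : comNzRingType := HB.pack K (GRing.PzSemiRing_isNonZero.Build K K1).
suff [X [Y XY]] : exists (X : 'M[K]_(n, r)) (Y : 'M[K]_(r, n)), X *m Y = 1%:M.
  exact: (@mulmx1_min K' n r X Y XY).
have [X XE] := choice (fun i => spe' (e i)); have [Y YE] := choice (fun j => spe (e' j)).
exists (\matrix_(i, j) X i j), (\matrix_(j, i) Y j i); apply/matrixP => i l.
apply/eqP; rewrite -subr_eq0; apply/eqP.
move: l; apply: fre; rewrite /=.
under eq_bigr do rewrite !mxE scalerBl scaler_suml.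
rewrite sumrB sum_delta exchange_big /= [X in _ - X]XE; apply/eqP; rewrite subr_eq0.
apply/eqP/eq_bigr => j _; rewrite [in RHS]YE scaler_sumr; apply: eq_bigr => l _.
by rewrite !mxE scalerA.
Qed.

Lemma basis_size n r (e : 'I_n -> V) (e' : 'I_r -> V) :
  is_basis e -> is_basis e' -> n = r.
Proof.
by move=> be be'; apply/eqP; rewrite eqn_leq !(basis_size_le be be', basis_size_le be' be).
Qed.

End Dimension.

Lemma tens_scale (R S : comPzRingType) (f : {rmorphism R -> S}) (V : lmodType R) (u : V) (z : S) :
  tens u (z : restr f S^o) = z *: (tens u (1 : restr f S^o) : base_change f V).
Proof. by rewrite [RHS](base_change_scaleE f) mulr1. Qed.

Section CyclicFibre.
Variables (R S : comPzRingType) (f : {rmorphism R -> S}).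
Hypotheses (S1 : (1 : S) != 0) (Sinv : forall z : S, z != 0 -> exists w, w * z = 1).
Variables (V : lmodType R) (T : {linear V -> V}) (v : nat -> V) (m : nat).
Hypothesis Tv : forall i, T (v i) = v i.+1.
Hypothesis spv : forall u, exists c : 'I_m -> R, u = \sum_(i < m) c i *: v i.
Hypothesis vm : v m = 0.

Local Notation fib z := (z : restr f S^o).
Local Notation VS := (base_change f V).

Lemma fibre_shift r (g : 'I_r -> nat) (z : 'I_r -> S) j :
  \sum_i tens (v (g i)) (fib (z i)) = 0 -> \sum_i tens (v (j + g i)%N) (fib (z i)) = 0.
Proof.
move=> fz0; elim: j => [//|j IHj].
have bal := @tensor_map_balanced _ V V (restr f S^o) _ T id
  (linearP T) (fun _ _ _ => erefl).
have := congr1 (tensor_map T id) IHj.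
rewrite /tensor_map (big_morph _ (tensor_liftD bal) (tensor_lift0 bal)) (tensor_lift0 bal) => h.
by rewrite -[RHS]h; apply: eq_bigr => i _; rewrite (tensor_lift_tens bal) Tv addSn.
Qed.

(** The fibre is a vector space generated by the orbit of [v 0] under a nilpotent
    endomorphism.  If [r] is the least exponent that kills [v 0], the
    first [r] iterates are independent -- a shift moves the lowest non-zero
    coefficient of a relation in front of [v r.-1] and kills all the others --
    and they span, so [r] is the dimension. *)
Lemma cyclic_fibre n : has_dim VS n ->
  (forall i, (n <= i)%N -> tens (v i) (fib 1) = 0) /\
  (forall z : 'I_n -> S, \sum_(i < n) tens (v i) (fib (z i)) = 0 -> forall i, z i = 0).
Proof.
move=> [e be].
have ex0 : exists r, tens (v r) (fib 1) == 0.
  by exists m; rewrite vm tens0l.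
case: (ex_minnP ex0) => r /eqP vr0 minr.
have v0 i : (r <= i)%N -> tens (v i) (fib 1) = 0.
  move=> /subnK<-.
  have := @fibre_shift 1 (fun=> r) (fun=> 1) (i - r).
  by rewrite !big_ord1 => ->.
have fre (z : 'I_r -> S) :
    \sum_(i < r) tens (v i) (fib (z i)) = 0 -> forall i, z i = 0.
  move=> z0 [l lr]; elim/ltn_ind: l lr => l IHl lr.
  set i0 := Ordinal lr; apply/eqP/negPn/negP => zl0.
  have := fibre_shift (r.-1 - l) z0.
  rewrite (bigD1 i0) //= big1 ?addr0 => [|[i ir] /eqP il].
    have -> : (r.-1 - l + l = r.-1)%N by rewrite subnK // -ltnS (ltn_predK lr).
    have [w wz] := Sinv zl0.
    rewrite tens_scale => /(congr1 (fun t : VS => w *: t)).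
    rewrite scalerA wz scale1r scaler0 => /eqP/minr.
    by rewrite leqNgt (ltn_predK lr) leqnn.
  rewrite /=; have [il'|li|il'] := ltngtP i l.
  - by rewrite (IHl _ il') tens0r.
  - by rewrite tens_scale v0 ?scaler0 //; lia.
  - by case: il; apply: val_inj.
suff nr : n = r by split=> [i|]; rewrite nr //; apply: v0.
apply: (basis_size S1 be (e' := fun i : 'I_r => tens (v i) (fib 1) : VS)).
split=> [z|t].
  by under eq_bigr do rewrite -tens_scale; apply: fre.
apply: submod_span_comb; elim/tensor_ind: t => [|t t' IHt IHt'|u z].
- exact: rpred0.
- exact: rpredD.
have [c ->] := spv u; rewrite tens_suml; apply: rpred_sum => i _.
rewrite tensZ tens_scale; apply: rpredZ; have [ir|ri] := ltnP i r.
  by apply: mem_submod_span; exists (Ordinal ir).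
by rewrite v0 ?rpred0.
Qed.

End CyclicFibre.

(** * Division by a monic polynomial with nilpotent lower coefficients *)

Lemma prime_idealX (R : comPzRingType) (P : primeIdeal R) (a : R) m :
  a ^+ m \in P -> a \in P.
Proof.
elim: m => [|m IHm]; first by rewrite expr0 (negPf (prime_ideal1 P)).
by rewrite exprS => /prime_idealM/orP[].
Qed.

Section SignedPoly.
Variables (A B : comPzRingType) (io : {rmorphism A -> B}) (x : B).
Variables (n : nat) (u : nat -> A).

Definition signed_poly : B :=
  x ^+ n + \sum_(1 <= i < n.+1) (-1) ^+ i * io (u i) * x ^+ (n - i).

Lemma signed_polyE :
  signed_poly = x ^+ n + \sum_(j < n) io ((-1) ^+ j.+1 * u j.+1) * x ^+ (n - j.+1).
Proof.
rewrite /signed_poly big_add1 big_mkord; congr (_ + _); apply: eq_bigr => j _.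
by rewrite (rmorphM io) (rmorphXn io) (rmorphN1 io).
Qed.

Hypothesis uN : forall i, (1 <= i <= n)%N -> nilpotent_elt (u i).

Let a j := (-1) ^+ j.+1 * u j.+1.

Lemma nilpotent_coef (j : 'I_n) : nilpotent_elt (a j).
Proof.
have [|m um] := uN (i := j.+1); first by rewrite /= ltn_ord.
by exists m; rewrite exprMn um mulr0.
Qed.

(** A prime ideal containing [signed_poly] contains the nilpotent lower
    coefficients, hence [x ^+ n] and [x]. *)
Lemma x_nilpotent_mod : radical (ideal_gen [set signed_poly]) x.
Proof.
apply: contrapT => /prime_ideal_avoiding[P [FP]]; apply/negP/negPn.
have ioP (j : 'I_n) : io (a j) \in P.
  have [m am] := nilpotent_coef j; apply: (@prime_idealX _ _ _ m).
  by rewrite -(rmorphXn io) am rmorph0; apply: ideal0.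
apply: (@prime_idealX _ _ _ n).
have -> : x ^+ n = signed_poly + -1 * \sum_(j < n) io (a j) * x ^+ (n - j.+1).
  by rewrite signed_polyE mulN1r addrK.
apply: idealD; first by apply: FP; apply: mem_ideal_gen.
by apply: ideal_mulr; apply: ideal_sum => j _; rewrite mulrC; apply: ideal_mulr.
Qed.

Definition has_rem (b : B) : Prop := exists (c : 'I_n -> A) (g : B),
  b = \sum_(i < n) io (c i) * x ^+ i + g * signed_poly.

Lemma has_remD b b' : has_rem b -> has_rem b' -> has_rem (b + b').
Proof.
move=> [c [g ->]] [c' [g' ->]]; exists (fun i => c i + c' i), (g + g').
rewrite mulrDl addrACA -big_split; congr (_ + _).
by apply: eq_bigr => i _; rewrite (rmorphD io) mulrDl.
Qed.

Lemma has_remZ s b : has_rem b -> has_rem (io s * b).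
Proof.
move=> [c [g ->]]; exists (fun i => s * c i), (io s * g).
rewrite mulrDr mulr_sumr mulrA; congr (_ + _).
by apply: eq_bigr => i _; rewrite (rmorphM io) mulrA.
Qed.

Lemma has_rem_sum I (r : seq I) (P : pred I) (G : I -> B) :
  (forall i, P i -> has_rem (G i)) -> has_rem (\sum_(i <- r | P i) G i).
Proof.
move=> GP; apply: (big_ind has_rem) => //; last exact: has_remD.
exists (fun=> 0), 0; rewrite mul0r addr0 big1 // => i _.
by rewrite rmorph0 mul0r.
Qed.

Lemma has_rem_mul g : has_rem (g * signed_poly).
Proof.
exists (fun=> 0), g; rewrite big1 ?add0r // => i _.
by rewrite rmorph0 mul0r.
Qed.

Lemma has_rem_low (i : 'I_n) : has_rem (x ^+ i).
Proof.
exists (fun j => (j == i)%:R), 0; rewrite mul0r addr0 (bigD1 i) //= eqxx rmorph1 mul1r.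
by rewrite big1 ?addr0 // => j /negPf->; rewrite rmorph0 mul0r.
Qed.

Lemma has_rem_Xn i : has_rem (x ^+ i).
Proof.
elim/ltn_ind: i => i IHi; have [ni|ni] := ltnP i n; first exact: (has_rem_low (Ordinal ni)).
have -> : x ^+ i = x ^+ (i - n) * signed_poly +
    \sum_(j < n) io (- a j) * x ^+ (i - j.+1).
  rewrite signed_polyE mulrDr -exprD subnK // -addrA mulr_sumr -big_split big1 ?addr0 //= => j _.
  rewrite mulrCA -exprD (_ : i - n + (n - j.+1) = i - j.+1)%N; last by have := ltn_ord j; lia.
  by rewrite (rmorphN io) mulNr subrr.
apply: has_remD; first exact: has_rem_mul.
apply: has_rem_sum => j _; apply: has_remZ; apply: IHi.
by have := ltn_ord j; lia.
Qed.

End SignedPoly.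

(** * The quotient as a module over the base *)

Section QuotientAsModule.
Variables (A B : comPzRingType) (io : {rmorphism A -> B}) (I : submodClosed B^o).

Local Notation M := (restr io (mquot I)).

Definition cls (b : B) : M := mquot_pi I (b : B^o).

Lemma cls_ind (T : M -> Prop) : (forall b, T (cls b)) -> forall v, T v.
Proof. exact: (@mquot_pi_ind B B^o I T). Qed.

Lemma clsD b b' : cls (b + b') = cls b + cls b'.
Proof. exact: (@mquot_piD B B^o I). Qed.

Lemma cls_eq0 b : (cls b == 0) = (b \in I).
Proof. exact: (@mquot_pi_eq0 B B^o I). Qed.

Lemma clsZ a b : cls (io a * b) = a *: cls b.
Proof. exact: esym (@mquot_scaleE B B^o I (io a) b). Qed.

Variable x : B.

Lemma cls_sum n (c : 'I_n -> A) :
  cls (\sum_(i < n) io (c i) * x ^+ i) = \sum_(i < n) c i *: cls (x ^+ i).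
Proof.
rewrite (big_morph cls clsD (id1 := 0)); last by apply/eqP; rewrite cls_eq0 ideal0.
by apply: eq_bigr => i _; rewrite clsZ.
Qed.

Definition mulx (v : M) : M := x *: (v : mquot I).

Lemma mulx_is_linear : linear mulx.
Proof.
move=> a v w; rewrite /mulx [LHS]scalerDr; congr (_ + _).
by rewrite -[LHS]/(x *: (io a *: (v : mquot I))) scalerA mulrC -scalerA.
Qed.

HB.instance Definition _ := GRing.isLinear.Build A M M *:%R mulx mulx_is_linear.

Lemma mulx_cls i : mulx (cls (x ^+ i)) = cls (x ^+ i.+1).
Proof. by rewrite exprS; exact: (@mquot_scaleE B B^o I x (x ^+ i)). Qed.

Variables (n m : nat).
Hypothesis spm : forall v : M, exists c : 'I_m -> A, v = \sum_(i < m) c i *: cls (x ^+ i).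

(** The fibres decide everything: there [x ^+ n] vanishes, so by Nakayama's
    lemma the quotient of [M] by the span of the first [n] powers of [x] is
    zero; and there the first [n] powers are independent, so flatness makes
    them a basis. *)
Lemma flat_fibre_dim_basis : flat M ->
  (forall P : primeIdeal A, has_dim (base_change (kappa_map P) M) n) ->
  x ^+ m \in I ->
  is_basis (fun i : 'I_n => cls (x ^+ i)) /\
  (forall P : primeIdeal A,
     tens (cls (x ^+ n)) (1 : restr (kappa_map P) (kappa P)^o) = 0).
Proof.
move=> flM dimM xm.
have xm0 : cls (x ^+ m) = 0 by apply/eqP; rewrite cls_eq0.
have fibM P := @cyclic_fibre _ _ _ (kappa_nonzero P) (@kappa_inv _ P) M mulx
  (fun i => cls (x ^+ i)) m mulx_cls spm xm0 n (dimM P).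
split=> [|P]; last exact: (proj1 (fibM P)).
apply: flat_basis => // [|P z]; last exact: (proj2 (fibM P)).
pose N := submod_span (range (fun i : 'I_n => cls (x ^+ i))).
have xN i : (i < n)%N -> cls (x ^+ i) \in N.
  by move=> ni; apply: mem_submod_span; exists (Ordinal ni).
have qN : forall i : 'I_m, mquot_pi N (cls (x ^+ i)) = 0.
  apply: eq0_of_fibres => [|P i].
    elim/mquot_pi_ind => v; have [c ->] := spm v; exists c.
    by rewrite raddf_sum; apply: eq_bigr => i _; exact: esym (mquot_scaleE N _ _).
  have [ni|ni] := ltnP i n.
    by have /eqP-> : mquot_pi N (cls (x ^+ i)) == 0; rewrite ?tens0l ?mquot_pi_eq0 ?xN.
  have bal := @tensor_map_balanced _ M (mquot N) (restr (kappa_map P) (kappa P)^o) _ (mquot_pi N) id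
    (linearP (mquot_pi N)) (fun _ _ _ => erefl).
  have := congr1 (tensor_map (mquot_pi N) id) (proj1 (fibM P) i ni).
  by rewrite /tensor_map (tensor_lift_tens bal) (tensor_lift0 bal).
move=> v; apply: submod_span_comb; have [c ->] := spm v.
by apply: rpred_sum => i _; apply: rpredZ; rewrite -mquot_pi_eq0 qN.
Qed.

End QuotientAsModule.

(** * The equivalence over an algebra with division by powers of x *)

Section PolynomialLike.
Variables (A B : comPzRingType) (io : {rmorphism A -> B}) (x : B) (n : nat).
Hypothesis trunc : forall m b, exists (c : 'I_m -> A) (d : B),
  b = \sum_(i < m) io (c i) * x ^+ i + d * x ^+ m.

(** Some power of [x] is a multiple of [signed_poly], so truncation modulo that
    power reduces the division to powers of [x]. *)
Lemma division (u : nat -> A) (uN : forall i, (1 <= i <= n)%N -> nilpotent_elt (u i)) b :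
  has_rem io x n u b.
Proof.
have [m /mem_ideal_gen1[h hE]] := x_nilpotent_mod io x uN.
have [c [d ->]] := trunc m b; apply: has_remD.
  by apply: has_rem_sum => i _; apply: has_remZ; apply: has_rem_Xn.
by rewrite hE mulrA; apply: has_rem_mul.
Qed.

Variable I : submodClosed B^o.
Local Notation cls := (cls io I).

Lemma cls_span m : x ^+ m \in I ->
  forall v, exists c : 'I_m -> A, v = \sum_(i < m) c i *: cls (x ^+ i).
Proof.
move=> xm; elim/cls_ind => b; have [c [d ->]] := trunc m b.
exists c; rewrite clsD cls_sum [X in _ + X](_ : _ = 0) ?addr0 //.
by apply/eqP; rewrite cls_eq0; apply: ideal_mulr.
Qed.

Lemma signed_poly_basis (u : nat -> A) :
  (forall i, (1 <= i <= n)%N -> nilpotent_elt (u i)) ->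
  (forall (c : 'I_n -> A) (b : B),
     \sum_(i < n) io (c i) * x ^+ i = b * signed_poly io x n u -> forall i, c i = 0) ->
  I =i ideal_gen [set signed_poly io x n u] ->
  is_basis (fun i : 'I_n => cls (x ^+ i)).
Proof.
move=> uN uniq IE; split=> [c|].
  rewrite -cls_sum => /eqP; rewrite cls_eq0 IE => /mem_ideal_gen1[b].
  exact: uniq.
elim/cls_ind => b; have [c [g ->]] := division uN b.
exists c; rewrite clsD cls_sum [X in _ + X](_ : _ = 0) ?addr0 //.
by apply/eqP; rewrite cls_eq0 IE; apply/mem_ideal_gen1; exists g.
Qed.

(** The expansion of [x ^+ n] in the basis of its lower powers is the generator
    of [I].  Its coefficients vanish in every fibre because [x ^+ n] does, and
    an element of [I] has remainder zero because remainders are coordinates in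
    the basis. *)
Lemma signed_poly_of_basis m : flat (restr io (mquot I)) ->
  (forall P : primeIdeal A, has_dim (base_change (kappa_map P) (restr io (mquot I))) n) ->
  x ^+ m \in I ->
  exists2 u : nat -> A, forall i, (1 <= i <= n)%N -> nilpotent_elt (u i) &
    I =i ideal_gen [set signed_poly io x n u].
Proof.
move=> flM dimM xm; have [[fre spn] xn0] := flat_fibre_dim_basis (cls_span xm) flM dimM xm.
have [d dE] := spn (cls (x ^+ n)).
have dN i : nilpotent_elt (d i).
  apply: nilpotent_kappa => P; move: i.
  apply: (tens_basis_eq0 (W := restr (kappa_map P) (kappa P)^o) (conj fre spn)).
  rewrite -[RHS](xn0 P) dE tens_suml; apply: eq_bigr => i _.
  exact: tens_kappa.
(* [x ^+ n = \sum_i d_i x ^+ i] in [M], so [(-1) ^+ i * u i] has to be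
   [- d_(n - i)]. *)
pose u i := if insub (n - i)%N is Some j then (-1) ^+ i.+1 * d j else 0.
have uN i : (1 <= i <= n)%N -> nilpotent_elt (u i).
  move=> _; rewrite /u; case: insubP => [j _ _|_]; last by exists 1%N; rewrite expr1.
  by have [r dr] := dN j; exists r; rewrite exprMn dr mulr0.
exists u => // ; have FI : signed_poly io x n u \in I.
  rewrite -(cls_eq0 io) signed_polyE clsD dE -cls_sum -clsD.
  rewrite (reindex_inj rev_ord_inj) -big_split big1 ?cls_eq0 ?ideal0 //= => j _.
  rewrite -mulrDl -(rmorphD io) [X in io X](_ : _ = 0) ?rmorph0 ?mul0r //.
  rewrite /u; case: insubP => [l _ lE|]; last by have := ltn_ord j; lia.
  rewrite mulrA -exprD addnS exprS -signr_odd oddD addbb mulr1 mulN1r.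
  by apply/eqP; rewrite subr_eq0; apply/eqP; congr d; apply: val_inj.
move=> b; apply/idP/idP => [bI|/mem_ideal_gen1[g ->]]; last exact: ideal_mulr.
have [c [g bE]] := division uN b.
have c0 : forall i, c i = 0.
  apply: fre; apply/eqP; rewrite -cls_sum cls_eq0.
  have -> : \sum_(i < n) io (c i) * x ^+ i = b + -1 * (g * signed_poly io x n u).
    by rewrite bE mulN1r addrK.
  by apply: idealD => //; do 2!apply: ideal_mulr.
apply/mem_ideal_gen1; exists g; rewrite bE big1 ?add0r // => i _.
by rewrite c0 rmorph0 mul0r.
Qed.

(** Existence and uniqueness of remainders together make [M] free on the first
    [n] powers of [x] when [signed_poly] generates [I]. *)
Theorem monic_nilpotent_quotient (M := restr io (mquot I)) :
  (forall u : nat -> A, (forall i, (1 <= i <= n)%N -> nilpotent_elt (u i)) ->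
   forall (c : 'I_n -> A) (b : B),
     \sum_(i < n) io (c i) * x ^+ i = b * signed_poly io x n u -> forall i, c i = 0) ->
  [/\ flat M,
      forall P : primeIdeal A, has_dim (base_change (kappa_map P) M) n
    & [set` ideal_gen [set x]] `<=` radical I]
  <->
  exists2 u : nat -> A,
    forall i, (1 <= i <= n)%N -> nilpotent_elt (u i) &
    I =i ideal_gen [set signed_poly io x n u].
Proof.
move=> uniq; split=> [[flM dimM xI]|[u uN IE]].
  have [|m xm] := xI x; first exact: mem_ideal_gen.
  exact: signed_poly_of_basis flM dimM xm.
have be := signed_poly_basis uN (uniq u uN) IE; split.
- exact: basis_flat be.
- by move=> P; apply: basis_base_change be.
move=> _ /mem_ideal_gen1[b ->].
have [m xm] := x_nilpotent_mod io x uN; exists m.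
by rewrite exprMn; apply: ideal_mulr; rewrite IE.
Qed.

End PolynomialLike.

(** * Power series coefficients *)

Section LocalizationFacts.
Variables (R : comPzRingType) (P : primeIdeal R).

Lemma loc_prime_clear (z : loc_prime P) :
  exists r s, s \notin P /\ z * loc_prime_map P s = loc_prime_map P r.
Proof.
elim/(@loc_ind _ (prime_compl P)): z => r s; exists r, (sval s).
split; first exact: (valP s).
apply: (etrans (loc_fracM _ _ _ _)); apply/loc_frac_eqP; exists 1; first exact: rpred1.
by rewrite /=; ring.
Qed.

Lemma loc_prime_map_eq (r r' : R) : loc_prime_map P r = loc_prime_map P r' ->
  exists2 u, u \notin P & u * r = u * r'.
Proof.
by move=> /loc_frac_eqP[u uP]; rewrite !mulr1 => e; exists u.
Qed.

End LocalizationFacts.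

Section PowerSeries.
Variable k : fieldType.

Local Notation inj := (loc_prime_map (polyX_prime k)).

Lemma coprime_Xn (s : {poly k}) N : s \notin polyX_prime k -> coprimep s 'X^N.
Proof.
move=> sP; apply: coprimep_expr; rewrite coprimepX; apply: contra sP => s0.
exact: etrans (mem_polyX_ideal s) s0.
Qed.

(** Denominators in [k[x]_(x)] are prime to ['X^N], hence invertible modulo it. *)
Lemma kX_truncate N (z : kX_loc k) : exists q w, z = inj q + w * inj 'X^N.
Proof.
have [p [s [sP zs]]] := loc_prime_clear z.
have /Bezout_eq1_coprimepP[[a b] /= ab] := coprime_Xn N sP.
exists (a * p), (z * inj b).
rewrite !rmorphM -zs mulrCA -rmorphM -mulrA -rmorphM -mulrDr -rmorphD ab.
by rewrite rmorph1 mulr1.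
Qed.

Lemma kX_truncate_uniq N (q q' : {poly k}) (w w' : kX_loc k) :
  inj q + w * inj 'X^N = inj q' + w' * inj 'X^N ->
  forall i, (i < N)%N -> q`_i = q'`_i.
Proof.
move=> qq' i iN; have [p [s [sP zs]]] := loc_prime_clear (w' - w).
have /loc_prime_map_eq[u uP] : inj (s * (q - q')) = inj (p * 'X^N).
  rewrite !rmorphM -zs rmorphB mulrAC mulrC; congr (_ * _).
  by apply/eqP; rewrite mulrBl subr_eq addrAC eq_sym subr_eq qq' addrC.
rewrite mulrA (mulrA u p) => e.
have usP : u * s \notin polyX_prime k.
  by apply/negP => /prime_idealM/orP[]; apply/negP.
have : 'X^N %| u * s * (q - q') by rewrite e dvdp_mull.
rewrite Gauss_dvdpr 1?coprimep_sym ?coprime_Xn // => /dvdpP[d qE].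
by have /eqP := coefMXn N d i; rewrite iN -qE coefB subr_eq0 => /eqP.
Qed.

(** The coefficient of degree [i] of the image of [z] in [k[[x]]]. *)
Definition kX_coef i (z : kX_loc k) : k := (sval (cid (kX_truncate i.+1 z)))`_i.

Lemma kX_coefE i N q (w : kX_loc k) : (i < N)%N ->
  kX_coef i (inj q + w * inj 'X^N) = q`_i.
Proof.
move=> iN; rewrite /kX_coef; case: cid => q' /= [w' e].
apply: (@kX_truncate_uniq i.+1 _ _ w' (w * inj 'X^(N - i.+1))); last by [].
by rewrite -e -mulrA -rmorphM -exprD subnK.
Qed.

Lemma kX_coefD i : {morph kX_coef i : z z' / z + z'}.
Proof.
move=> z z'; have [q [w ->]] := kX_truncate i.+1 z.
have [q' [w' ->]] := kX_truncate i.+1 z'.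
rewrite addrACA -mulrDl -rmorphD !kX_coefE //; exact: coefD.
Qed.

Lemma kX_coefZ i (c : k) z : kX_coef i (kX_loc_map k c * z) = c * kX_coef i z.
Proof.
have [q [w ->]] := kX_truncate i.+1 z.
rewrite -[kX_loc_map k c]/(inj c%:P) mulrDr mulrA -rmorphM !kX_coefE //.
exact: coefCM.
Qed.

Lemma kX_coefX i z : kX_coef i (inj 'X * z) = if i is j.+1 then kX_coef j z else 0.
Proof.
have [q [w ->]] := kX_truncate i.+1 z.
rewrite mulrDr mulrA -rmorphM !kX_coefE // coefXM.
by case: i w => // i w; rewrite kX_coefE.
Qed.

Lemma kX_coef1 i : kX_coef i 1 = (i == 0)%:R.
Proof.
have -> : 1 = inj 1 + 0 * inj 'X^(i.+1) by rewrite mul0r addr0 rmorph1.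
by rewrite kX_coefE // coef1.
Qed.

End PowerSeries.

(** * Expansions in A (x) k[x]_(x) *)

Section AXloc.
Variables (k : fieldType) (A : comPzRingType) (phi : {rmorphism k -> A}).

Local Notation B := (AX_loc phi).
Local Notation io := (AX_loc_in phi).
Local Notation x := (AX_loc_x phi).
Local Notation inj := (loc_prime_map (polyX_prime k)).
Local Notation inr := (alg_inr phi (kX_loc_map k)).

Lemma AX_loc_ind (T : B -> Prop) : T 0 -> (forall b b', T b -> T b' -> T (b + b')) ->
  (forall a z, T (io a * inr z)) -> forall b, T b.
Proof.
move=> T0 TD Tt; apply: algtens_ind => // a z.
by have := Tt a z; rewrite [X in T X]atensM mulr1 mul1r.
Qed.

Lemma inr_const c : inr (kX_loc_map k c) = io (phi c).
Proof.
transitivity (atens phi (kX_loc_map k) 1 (kX_loc_map k c * 1)); first by rewrite mulr1.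
transitivity (atens phi (kX_loc_map k) (phi c * 1) 1); last by rewrite mulr1.
exact: esym (tensZ (V := restr phi A^o) (W := restr (kX_loc_map k) (kX_loc k)^o) c 1 1).
Qed.

Lemma inrD z w : inr (z + w) = inr z + inr w.
Proof. exact: (rmorphD inr). Qed.

Lemma inrM z w : inr (z * w) = inr z * inr w.
Proof. exact: (rmorphM inr). Qed.

Lemma inr_mulX z : inr (inj 'X * z) = x * inr z.
Proof. exact: inrM. Qed.

Lemma inr_monomial c i : inr (inj (c *: 'X^i)) = io (phi c) * x ^+ i.
Proof.
rewrite -mul_polyC rmorphM; apply: (etrans (inrM _ _)).
by rewrite -inr_const rmorphXn; congr (_ * _); apply: (rmorphXn inr).
Qed.

Lemma inr_Xn N : inr (inj 'X^N) = x ^+ N.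
Proof. by rewrite !rmorphXn. Qed.

(** The coefficient of degree [i] of the image of an element of [AX_loc phi] in
    [A[[x]]]. *)
Definition AX_coef i : B -> A :=
  tensor_lift (fun (a : restr phi A^o) (z : restr (kX_loc_map k) (kX_loc k)^o) =>
    (a : A) * phi (kX_coef i (z : kX_loc k))).

Lemma AX_coef_balanced i :
  balanced (fun (a : restr phi A^o) (z : restr (kX_loc_map k) (kX_loc k)^o) =>
    (a : A) * phi (kX_coef i (z : kX_loc k))).
Proof.
split=> [a a' z|a z z'|c a z]; first exact: mulrDl.
  by rewrite kX_coefD rmorphD mulrDr.
by rewrite [kX_coef i (c *: z)]kX_coefZ rmorphM -[(c *: a : A)]/(phi c * a) mulrA (mulrC a).
Qed.

Lemma AX_coefD i : {morph AX_coef i : b b' / b + b'}.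
Proof. exact: (tensor_liftD (AX_coef_balanced i)). Qed.

Lemma AX_coef0 i : AX_coef i 0 = 0.
Proof. exact: (tensor_lift0 (AX_coef_balanced i)). Qed.

Lemma AX_coef_tens i a z : AX_coef i (io a * inr z) = a * phi (kX_coef i z).
Proof.
rewrite [io a * inr z]atensM mulr1 mul1r.
exact: (tensor_lift_tens (AX_coef_balanced i)).
Qed.

Lemma AX_coef_sum i (I : Type) (r : seq I) (P : pred I) (F : I -> B) :
  AX_coef i (\sum_(j <- r | P j) F j) = \sum_(j <- r | P j) AX_coef i (F j).
Proof. by apply: (big_morph (AX_coef i) _ (AX_coef0 i)) => u v; apply: AX_coefD. Qed.

Lemma AX_coefZ i a b : AX_coef i (io a * b) = a * AX_coef i b.
Proof.
elim/AX_loc_ind: b => [|b b' IHb IHb'|c z]; first by rewrite mulr0 AX_coef0 mulr0.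
  by rewrite mulrDr !AX_coefD IHb IHb' mulrDr.
by rewrite mulrA -rmorphM !AX_coef_tens mulrA.
Qed.

Lemma AX_coefX i b : AX_coef i (x * b) = if i is j.+1 then AX_coef j b else 0.
Proof.
elim/AX_loc_ind: b => [|b b' IHb IHb'|c z].
- by rewrite mulr0 AX_coef0; case: i => // i; rewrite AX_coef0.
- by rewrite mulrDr AX_coefD IHb IHb'; case: i {IHb IHb'} => [|i]; rewrite ?addr0 ?AX_coefD.
transitivity (AX_coef i (io c * inr (inj 'X * z))).
  by apply: (congr1 (AX_coef i)); rewrite inr_mulX; exact: mulrCA.
rewrite AX_coef_tens kX_coefX.
by case: i => [|i]; rewrite ?AX_coef_tens // rmorph0 mulr0.
Qed.

Lemma AX_coefXn i j b :
  AX_coef i (x ^+ j * b) = if (j <= i)%N then AX_coef (i - j) b else 0.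
Proof.
elim: j i => [|j IHj] i; first by rewrite expr0 mul1r subn0.
rewrite exprS -mulrA AX_coefX; case: i => [//|i].
by rewrite IHj.
Qed.

Lemma AX_coef1 i : AX_coef i 1 = (i == 0)%:R.
Proof.
have -> : 1 = io 1 * inr 1 by rewrite !rmorph1 mulr1.
by rewrite AX_coef_tens kX_coef1 mul1r rmorph_nat.
Qed.

Lemma AX_coef_poly n (c : 'I_n -> A) i :
  AX_coef i (\sum_(j < n) io (c j) * x ^+ j) = \sum_(j < n) c j * (i == j)%:R.
Proof.
rewrite AX_coef_sum; apply: eq_bigr => j _; rewrite AX_coefZ; congr (_ * _).
rewrite -[x ^+ j]mulr1 AX_coefXn AX_coef1 subn_eq0.
by case: ltngtP.
Qed.

Lemma AX_loc_truncate m b : exists (c : 'I_m -> A) (d : B),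
  b = \sum_(i < m) io (c i) * x ^+ i + d * x ^+ m.
Proof.
elim/AX_loc_ind: b => [|_ _ [c [d ->]] [c' [d' ->]]|a z].
- exists (fun=> 0), 0; rewrite mul0r addr0 big1 // => i _.
  by rewrite rmorph0 mul0r.
- exists (fun i => c i + c' i), (d + d'); rewrite mulrDl addrACA -big_split.
  by congr (_ + _); apply: eq_bigr => i _; rewrite rmorphD mulrDl.
have [q [w ->]] := kX_truncate m z.
exists (fun i => a * phi q`_i), (io a * inr (inj (drop_poly m q) + w)).
rewrite -[in LHS](poly_take_drop m q) (rmorphD inj) -addrA (rmorphM inj) -mulrDl.
rewrite inrD inrM inr_Xn mulrDr mulrA; congr (_ + _).
rewrite /take_poly poly_def (rmorph_sum inj) (rmorph_sum inr) mulr_sumr.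
apply: eq_bigr => i _; rewrite (rmorphM io) -mulrA; congr (_ * _); exact: inr_monomial.
Qed.

End AXloc.

(** * Uniqueness of remainders *)

(** Each application of the recurrence multiplies by one more factor [a j].  So,
    by induction on the room [\sum_j (r j - e j)] left below the exponents of
    nilpotency [r], every product of powers of the [a j] kills [beta]; the empty
    product gives the claim. *)
Lemma nilpotent_recurrence (A : comPzRingType) n (a : 'I_n -> A) (beta : nat -> A) :
  (forall j, nilpotent_elt (a j)) ->
  (forall i, beta i = \sum_j a j * beta (i + j.+1)%N) -> forall i, beta i = 0.
Proof.
move=> /choice[r ar] betaE.
suff h w : forall e : 'I_n -> nat, (\sum_j (r j - e j) <= w)%N ->
    forall i, \prod_j a j ^+ e j * beta i = 0.
  move=> i; have := h _ (fun=> 0%N) (leqnn _) i.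
  by rewrite big1 ?mul1r.
elim: w => [|w IHw] e ew i; rewrite betaE mulr_sumr big1 // => j _.
all: have [rj|ej] := leqP (r j) (e j);
  first by rewrite (bigD1 j) //= -(subnK rj) exprD ar mulr0 !mul0r.
all: have rej : (r j - e j = (r j - (e j).+1).+1)%N by lia.
all: move: ew; rewrite (bigD1 j) //= rej addSn // ltnS => ew.
have := IHw (fun l => if l == j then (e j).+1 else e l) _ (i + j.+1)%N.
rewrite !(bigD1 j (P := xpredT)) //= eqxx.
rewrite (eq_bigr (fun l => r l - e l)%N) => [|l /negPf-> //].
move=> /(_ ew); rewrite (eq_bigr (fun l => a l ^+ e l)) => [<-|l /negPf-> //].
by rewrite exprSr !mulrA; congr (_ * _); rewrite mulrAC.
Qed.

Section Uniqueness.
Variables (k : fieldType) (A : comPzRingType) (phi : {rmorphism k -> A}).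
Variables (n : nat) (u : nat -> A).
Hypothesis uN : forall i, (1 <= i <= n)%N -> nilpotent_elt (u i).

Local Notation io := (AX_loc_in phi).
Local Notation x := (AX_loc_x phi).

Let a j := (-1) ^+ j.+1 * u j.+1.

Lemma AX_coef_mul_signed b l : AX_coef l (b * signed_poly io x n u) =
  (if (n <= l)%N then AX_coef (l - n) b else 0) +
  \sum_(j < n) a j * (if (n - j.+1 <= l)%N then AX_coef (l - (n - j.+1)) b else 0).
Proof.
rewrite signed_polyE mulrDr AX_coefD mulrC AX_coefXn mulr_sumr AX_coef_sum.
congr (_ + _); apply: eq_bigr => j _.
by rewrite mulrCA AX_coefZ -AX_coefXn [b * _]mulrC.
Qed.

(** In degrees [n] and higher, the coefficients of [b * signed_poly] vanish: this
    is a recurrence with nilpotent coefficients for those of [b], which forces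
    them to be zero. *)
Lemma division_unique (c : 'I_n -> A) b :
  \sum_(i < n) io (c i) * x ^+ i = b * signed_poly io x n u -> forall i, c i = 0.
Proof.
move=> cb; have b0 : forall i, AX_coef i b = 0.
  apply: (@nilpotent_recurrence A n (fun j => - a j)) => [j|i].
    have [m am] := nilpotent_coef uN j; exists m.
    by rewrite exprNn am mulr0.
  have := congr1 (AX_coef (n + i)) cb; rewrite AX_coef_poly AX_coef_mul_signed.
  rewrite leq_addr addKn big1 => [/esym/eqP|j _]; last first.
    by rewrite (_ : _ == _ = false) ?mulr0 //; apply/negbTE; rewrite neq_ltn orbC ltn_addr.
  rewrite addr_eq0 => /eqP->; rewrite -sumrN; apply: eq_bigr => j _.
  rewrite mulNr; congr (- (_ * _)); rewrite ifT; last by lia.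
  by congr (AX_coef _ _); have := ltn_ord j; lia.
move=> i; have := congr1 (AX_coef i) cb; rewrite AX_coef_poly AX_coef_mul_signed.
rewrite (bigD1 i) //= eqxx mulr1 big1 ?addr0 => [->|j]; last first.
  by rewrite eq_sym => /negPf ji; rewrite [_ == _]ji mulr0.
by rewrite b0 if_same add0r big1 // => j _; rewrite b0 if_same mulr0.
Qed.

End Uniqueness.

(** * The equivalence *)

(* The ring structures of [AX_loc phi] reached along different paths of the
   hierarchy are built from one common record.  Conversion has to compare them
   without unfolding this record, whose normal form is huge. *)
Strategy opaque [Defs.HB_unnamed_factory_332].

Theorem theorem3p5 (k : fieldType) (n : nat) (n_gt0 : (0 < n)%N)
    (A : comPzRingType) (phi : {rmorphism k -> A})
    (I : submodClosed (AX_loc phi)^o) :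
  let M : lmodType A := restr (AX_loc_in phi) (mquot I) in
  let x : AX_loc phi := AX_loc_x phi in
  [/\ flat M,
      forall P : primeIdeal A, has_dim (base_change (kappa_map P) M) n
    & [set` ideal_gen [set x]] `<=` radical I]
  <->
  exists2 u : nat -> A,
    forall i, (1 <= i <= n)%N -> nilpotent_elt (u i) &
    I =i ideal_gen [set x ^+ n
      + \sum_(1 <= i < n.+1) (-1) ^+ i * AX_loc_in phi (u i) * x ^+ (n - i)].
Proof.
exact (@monic_nilpotent_quotient A (AX_loc phi) (AX_loc_in phi) (AX_loc_x phi) n
  (@AX_loc_truncate k A phi) I (fun u uN => @division_unique k A phi n u uN)).
Qed.
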